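(* Let $q>0$ and let $X_1,\ldots,X_n$ be i.i.d. real random variables with law $\mu(dx)=\phi(x)dx$, where $\phi$ is even with integrable and positive Fourier transform $\hat\phi$. (A) Suppose $t\mapsto\hat\phi(t^{1/q})$ is log-convex on $(0,+\infty)$. Then for each $p\in(0,2]$ and each $\lambda>0$ the function $$(0,+\infty)^n\ni a\mapsto \mathbb{E}\,e^{-\lambda\left|a_1^{1/q}X_1+\cdots+a_n^{1/q}X_n\right|^p}$$ is log-convex. In particular, if $\mathbb{E}|X_1|^p<+\infty$ for some $p\in(0,2]$, then the function $$(0,+\infty)^n\ni a\mapsto\mathbb{E}\left|a_1^{1/q}X_1+\cdots+a_n^{1/q}X_n\right|^p$$ is concave. (B) If instead $t\mapsto\hat\phi(t^{1/q})$ is log-concave on $(0,+\infty)$, then for each $p\in(0,2]$ and $\lambda>0$ the first function is Schur concave, and if $\mathbb{E}|X_1|^p<+\infty$ for some $p\in(0,2]$ the second function is Schur convex.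
   Context: Fourier transform convention: $\hat f(x)=\int_{\mathbb{R}}f(y)e^{-2\pi i xy}\,dy$. ''Positive'' for a Fourier transform means $\ge 0$. A function $f:C\to[0,\infty)$ on a convex set $C$ is log-convex (resp. log-concave) if $f(\lambda x+(1-\lambda)y)\le f(x)^\lambda f(y)^{1-\lambda}$ (resp. $\ge$) for all $x,y\in C$, $\lambda\in(0,1)$. For $x,y\in\mathbb{R}^n$, write $x\prec y$ if, after rearranging the coordinates of each in decreasing order, $x_1+\cdots+x_i\le y_1+\cdots+y_i$ for $i=1,\ldots,n-1$ and $x_1+\cdots+x_n=y_1+\cdots+y_n$. A function $f$ is Schur convex (resp. Schur concave) if $x\prec y$ implies $f(x)\le f(y)$ (resp. $f(x)\ge f(y)$) for all $x,y$ in its domain. *)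

(* Defs.v *)
From HB Require Import structures.
From mathcomp Require Import all_boot all_order all_algebra.
From mathcomp Require Import all_classical all_reals all_analysis.
From mathcomp Require Import complex.
Import Order.TTheory GRing.Theory Num.Theory.
Import numFieldNormedType.Exports.

Set Implicit Arguments.
Unset Strict Implicit.
Unset Printing Implicit Defensive.

Local Open Scope classical_set_scope.
Local Open Scope ring_scope.

Definition Cintegrable (R : realType) (f : R -> R[i]) : Prop :=
  (@lebesgue_measure R).-integrable setT (fun x => (complex.Re (f x))%:E) /\
  (@lebesgue_measure R).-integrable setT (fun x => (complex.Im (f x))%:E).

Definition Cintegral (R : realType) (f : R -> R[i]) : R[i] :=
  Complex (\int[@lebesgue_measure R]_x complex.Re (f x))
          (\int[@lebesgue_measure R]_x complex.Im (f x)).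

(* e^{i theta} *)
Definition expi (R : realType) (theta : R) : R[i] :=
  Complex (cos theta) (sin theta).

Definition fourier (R : realType) (f : R -> R) (x : R) : R[i] :=
  Cintegral (fun y : R => (f y)%:C%C * expi (- (2 * pi * x * y))).

Definition log_convex (R : realType) (V : lmodType R) (C : set V)
    (f : V -> R) : Prop :=
  (forall x, C x -> 0 <= f x) /\
  forall (x y : V) (l : R), C x -> C y -> 0 < l < 1 ->
    f (l *: x + (1 - l) *: y) <= f x `^ l * f y `^ (1 - l).

Definition log_concave (R : realType) (V : lmodType R) (C : set V)
    (f : V -> R) : Prop :=
  (forall x, C x -> 0 <= f x) /\
  forall (x y : V) (l : R), C x -> C y -> 0 < l < 1 ->
    f x `^ l * f y `^ (1 - l) <= f (l *: x + (1 - l) *: y).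

Definition concave_function (R : realType) (V : lmodType R) (C : set V)
    (f : V -> R) : Prop :=
  convex_function C (fun x => - f x).

Definition decreasing_rearrangement (R : realType) (n : nat) (x : 'rV[R]_n) :
    seq R :=
  sort >=%R [seq x 0 i | i <- enum 'I_n].

Definition majorized (R : realType) (n : nat) (x y : 'rV[R]_n) : Prop :=
  (forall i : nat, (1 <= i < n)%N ->
     \sum_(j < i) (decreasing_rearrangement x)`_j
     <= \sum_(j < i) (decreasing_rearrangement y)`_j) /\
  \sum_(j < n) x 0 j = \sum_(j < n) y 0 j.

Definition schur_convex (R : realType) (n : nat) (C : set 'rV[R]_n)
    (f : 'rV[R]_n -> R) : Prop :=
  forall x y, C x -> C y -> majorized x y -> f x <= f y.

Definition schur_concave (R : realType) (n : nat) (C : set 'rV[R]_n)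
    (f : 'rV[R]_n -> R) : Prop :=
  forall x y, C x -> C y -> majorized x y -> f y <= f x.

Definition pos_orthant (R : realType) (n : nat) : set 'rV[R]_n :=
  [set a | forall i, 0 < a 0 i].

Definition mutually_independent (d : measure_display) (T : measurableType d)
    (R : realType) (P : probability T R) (n : nat) (X : 'I_n -> {RV P >-> R}) :
    Prop :=
  forall (J : {set 'I_n}) (B : 'I_n -> set R),
    (forall i, measurable (B i)) ->
    P (\bigcap_(i in [set` J]) (X i @^-1` B i)) =
    (\prod_(i in J) P (X i @^-1` B i))%E.

Definition has_density (d : measure_display) (T : measurableType d)
    (R : realType) (P : probability T R) (X : {RV P >-> R}) (phi : R -> R) :
    Prop :=
  measurable_fun setT phi /\
  forall A : set R, measurable A ->
    distribution P X A = (\int[@lebesgue_measure R]_(x in A) (phi x)%:E)%E.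

(* a_1^{1/q} X_1 + ... + a_n^{1/q} X_n *)
Definition weighted_sum (d : measure_display) (T : measurableType d)
    (R : realType) (P : probability T R) (n : nat) (X : 'I_n -> {RV P >-> R})
    (q : R) (a : 'rV[R]_n) (w : T) : R :=
  \sum_(i < n) a 0 i `^ q^-1 * X i w.

(* The integrand is bounded and P is a probability, so [fine] loses nothing. *)
Definition laplace_moment (d : measure_display) (T : measurableType d)
    (R : realType) (P : probability T R) (n : nat) (X : 'I_n -> {RV P >-> R})
    (q p lambda : R) (a : 'rV[R]_n) : R :=
  fine 'E_P[(fun w => expR (- lambda * `|weighted_sum X q a w| `^ p))%R].

(* Finite, hence faithfully read through [fine], as soon as every X_i has a
   finite absolute p-th moment. *)
Definition abs_moment (d : measure_display) (T : measurableType d)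
    (R : realType) (P : probability T R) (n : nat) (X : 'I_n -> {RV P >-> R})
    (q p : R) (a : 'rV[R]_n) : R :=
  fine 'E_P[(fun w => `|weighted_sum X q a w| `^ p)%R].

(* Main.v *)
Require Import Defs.
From HB Require Import structures.
From mathcomp Require Import all_boot all_order all_algebra.
From mathcomp Require Import all_classical all_reals all_analysis.
From mathcomp Require Import complex.
From mathcomp Require Import measurable_realfun ring lra.
Import Order.TTheory GRing.Theory Num.Theory.
Import numFieldNormedType.Exports.

Set Implicit Arguments.
Unset Strict Implicit.
Unset Printing Implicit Defensive.

Local Open Scope classical_set_scope.
Local Open Scope ring_scope.

(** The function exp (- lambda |x|^p) is, for 0 < p <= 2, the characteristic
    function of a symmetric p-stable law, hence a nonnegative mixture of the
    functions cos (t x). By independence and symmetry, with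
    psi u = fourier phi (u^(1/q)),

      E cos (t S_a) = \prod_i fourier phi (|t| a_i^(1/q) / 2 pi)
                    = \prod_i psi (s a_i)     with s = (|t| / 2 pi)^q,

    so that E exp (- lambda |S_a|^p) is a nonnegative mixture of the products
    \prod_i psi (s a_i). If psi is log-convex, so are these products in a, and by
    Hoelder's inequality so are their mixtures. If psi is log-concave, the
    products are Schur concave by Karamata's inequality applied to - ln psi
    (log_concave_prod_schur), and Schur concavity clearly passes to mixtures.
    The moments are obtained from (1 - E exp (- h |S_a|^p)) / h -> E |S_a|^p as
    h -> 0 (cvg_laplace_abs_moment), a log-convex function being convex.

    Stable laws are not constructed. Instead, cos_cone is the closure of the
    cosines under sums, nonnegative multiples and bounded pointwise limits; it is
    closed under products, hence under power series with nonnegative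
    coefficients. Log-convexity and Schur concavity of a |-> E f(S_a) are
    preserved by the operations that generate the cone (cos_cone_expectation), so
    it suffices that exp (- lambda |x|^p) belongs to it (cos_cone_stable). For
    this, 1 - (1 - y)^(p/2) is a power series with nonnegative coefficients,
    whence exp (- mu (1 - r cos^2 (t x))^(p/2)) belongs to the cone for
    0 <= r < 1; letting r tend to 1 yields exp (- mu |sin (t x)|^p), and
    lambda |sin (t x) / t|^p tends to lambda |x|^p as t -> 0.

    The product formula for E cos (t S_a) needs independence for bounded
    measurable functions (indep_prod) and the integration of such functions
    against the density (expectation_density); both follow from the case of
    indicators by uniform approximation with step functions
    (bounded_functional_eq0). The sine transforms vanish because a nonnegative
    complex number is real. *)

(** * Nonnegative mixtures of cosines *)

Lemma ler_cvgn {R : realType} (u v : nat -> R) (a b : R) :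
  u n @[n --> \oo] --> a -> v n @[n --> \oo] --> b ->
  (forall n, u n <= v n) -> a <= b.
Proof.
move=> ua vb uv; rewrite -(cvg_lim _ ua)// -(cvg_lim _ vb)//.
by apply: ler_lim; [apply: cvgP ua|apply: cvgP vb|near=> n; exact: uv].
Unshelve. all: by end_near. Qed.

Lemma cvgn_norm_le {R : realType} (u : nat -> R) (l M : R) :
  (forall n, `|u n| <= M) -> u n @[n --> \oo] --> l -> `|l| <= M.
Proof.
move=> uM ul.
have nul : `|u n| @[n --> \oo] --> `|l| by apply: cvg_norm.
rewrite -(cvg_lim _ nul)//; apply: limr_le; first by apply: cvgP nul.
by near=> n; exact: uM.
Unshelve. all: by end_near. Qed.

(** Nonnegative mixtures of the functions cos (t x), in a generalized sense: the
    smallest family of functions that contains them and is closed under sums,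
    multiplication by nonnegative constants, and pointwise limits of uniformly
    bounded sequences. The mixing measures are not represented; a discontinuous
    limit has none. *)
Inductive cos_cone (R : realType) : (R -> R) -> Prop :=
| cos_cone_cos (t : R) : cos_cone (fun x => cos (t * x))
| cos_coneD (f g : R -> R) :
    cos_cone f -> cos_cone g -> cos_cone (fun x => f x + g x)
| cos_coneZ (c : R) (f : R -> R) :
    0 <= c -> cos_cone f -> cos_cone (fun x => c * f x)
| cos_cone_lim (f_ : nat -> R -> R) (f : R -> R) (M : R) :
    (forall n, cos_cone (f_ n)) -> (forall n x, `|f_ n x| <= M) ->
    (forall x, f_ n x @[n --> \oo] --> f x) -> cos_cone f.

Section cos_cone_theory.
Context {R : realType}.
Implicit Types (f g : R -> R).

Lemma cos_cone_bounded f : cos_cone f -> exists M : R, forall x, `|f x| <= M.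
Proof.
elim=> {f} [t|f g _ [M fM] _ [N gN]|c f c0 _ [M fM]|f_ f M _ _ fM ff].
- by exists 1 => x; rewrite ler_norml cos_geN1 cos_le1.
- exists (M + N) => x; rewrite (le_trans (ler_normD _ _))//.
  by rewrite lerD ?fM ?gN.
- exists (c * M) => x; rewrite normrM ger0_norm//.
  by rewrite ler_wpM2l ?fM.
- by exists M => x; apply: cvgn_norm_le (ff x).
Qed.

Lemma cos_cone_measurable f : cos_cone f -> measurable_fun setT f.
Proof.
elim=> {f} [t|f g _ fM _ gN|c f c0 _ fM|f_ f M _ mf fM ff].
- apply: measurableT_comp.
    by apply: continuous_measurable_fun; exact: continuous_cos.
  exact: measurable_funM.
- exact: measurable_funD.
- exact: measurable_funM.
- by apply: measurable_fun_cvg => // x _; exact: ff.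
Qed.

Lemma cos_cone_eq f g : cos_cone f -> f =1 g -> cos_cone g.
Proof. by move=> cf /funext <-. Qed.

Lemma cos_cone_cst (c : R) : 0 <= c -> cos_cone (fun=> c).
Proof.
move=> c0; apply: (cos_cone_eq (cos_coneZ c0 (cos_cone_cos 0))) => x.
by rewrite mul0r cos0 mulr1.
Qed.

Let cos_coneM_cos (t : R) g : cos_cone g -> cos_cone (fun x => cos (t * x) * g x).
Proof.
elim=> {g} [s|f g _ cf _ cg|c f c0 _ cf|f_ f M _ cf fM ff].
- have h0 : 0 <= 2^-1 :> R by [].
  apply: (cos_cone_eq (cos_coneD (cos_coneZ h0 (cos_cone_cos (t + s)))
    (cos_coneZ h0 (cos_cone_cos (t - s))))) => x.
  by rewrite mulrDl mulrBl cosD cosB; lra.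
- by apply: (cos_cone_eq (cos_coneD cf cg)) => x; rewrite mulrDr.
- by apply: (cos_cone_eq (cos_coneZ c0 cf)) => x; rewrite mulrCA.
- apply: (cos_cone_lim cf (M := M)) => [n x|x].
    rewrite normrM -[leRHS]mul1r ler_pM//.
    by rewrite ler_norml cos_geN1 cos_le1.
  by apply: cvgM; [exact: cvg_cst|exact: ff].
Qed.

(** The cone is multiplicative because a product of two cosines is half the
    sum of two cosines. *)
Lemma cos_coneM f g :
  cos_cone f -> cos_cone g -> cos_cone (fun x => f x * g x).
Proof.
move=> + cg; elim=> {f} [s|f h _ cf _ ch|c f c0 _ cf|f_ f M _ cf fM ff].
- exact: cos_coneM_cos.
- by apply: (cos_cone_eq (cos_coneD cf ch)) => x; rewrite mulrDl.
- by apply: (cos_cone_eq (cos_coneZ c0 cf)) => x; rewrite mulrA.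
- have [N gN] := cos_cone_bounded cg.
  apply: (cos_cone_lim cf (M := M * N)) => [n x|x].
    by rewrite normrM ler_pM.
  by apply: cvgM; [exact: ff|exact: cvg_cst].
Qed.

Lemma cos_coneX f n : cos_cone f -> cos_cone (fun x => f x ^+ n).
Proof.
move=> cf; elim: n => [|n ih]; first exact: cos_cone_cst.
by apply: (cos_cone_eq (cos_coneM cf ih)) => x; rewrite exprS.
Qed.

Lemma cos_cone_sum n (f : nat -> R -> R) : (forall i, cos_cone (f i)) ->
  cos_cone (fun x => \sum_(0 <= i < n) f i x).
Proof.
move=> cf; elim: n => [|n ih].
  by apply: (cos_cone_eq (@cos_cone_cst 0 _)) => // x; rewrite big_nil.
by apply: (cos_cone_eq (cos_coneD ih (cf n))) => x; rewrite big_nat_recr.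
Qed.

Lemma is_cvg_pseries_le (c : nat -> R) (M x : R) : (forall k, 0 <= c k) ->
  `|x| <= M -> cvgn (pseries c M) -> cvgn (pseries c x).
Proof.
move=> c0 xM cM; have M0 : 0 <= M := le_trans (normr_ge0 _) xM.
apply: normed_cvg; apply: series_le_cvg cM => [n|n|n] //=.
- by rewrite mulr_ge0// exprn_ge0.
- by rewrite normrM ger0_norm// ler_wpM2l// normrX lerXn2r// ?nnegrE.
Qed.

(** A power series with nonnegative coefficients, convergent at a bound of
    |f|, preserves the cone. *)
Lemma cos_cone_pseries (c : nat -> R) (M : R) f : (forall k, 0 <= c k) ->
  cos_cone f -> (forall x, `|f x| <= M) -> cvgn (pseries c M) ->
  cos_cone (fun x => limn (pseries c (f x))).
Proof.
move=> c0 cf fM cM; have M0 : 0 <= M := le_trans (normr_ge0 _) (fM 0).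
apply: (@cos_cone_lim _ (fun n x => pseries c (f x) n) _ (limn (pseries c M))).
- by move=> n; apply: cos_cone_sum => i; apply: cos_coneZ => //; exact: cos_coneX.
- move=> n x; apply: (@le_trans _ _ (pseries c M n)).
    rewrite /pseries /= /series/= (le_trans (ler_norm_sum _ _ _))//.
    apply: ler_sum => i _.
    by rewrite normrM ger0_norm// ler_wpM2l// normrX lerXn2r// ?nnegrE.
  apply: nondecreasing_cvgn_le => //; apply: nondecreasing_series => k _ _.
  by rewrite mulr_ge0// exprn_ge0.
- by move=> x; exact: is_cvg_pseries_le cM.
Qed.

Lemma cos_cone_expR f : cos_cone f -> cos_cone (fun x => expR (f x)).
Proof.
move=> cf; have [M fM] := cos_cone_bounded cf.
have expE x : expR x = limn (pseries (fun n : nat => n`!%:R^-1) x).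
  by rewrite /expR exp_coeffE.
apply: (cos_cone_eq (@cos_cone_pseries (fun n : nat => n`!%:R^-1) M f _ cf fM _)).
- by move=> k; rewrite invr_ge0.
- by have := is_cvg_series_exp_coeff M; rewrite exp_coeffE.
- by move=> x; rewrite expE.
Qed.

End cos_cone_theory.

(** * The binomial series *)

Section binomial_series.
Context {R : realType}.
Variable alpha : R.
Hypotheses (alpha_gt0 : 0 < alpha) (alpha_le1 : alpha <= 1).

(** Taylor coefficient of (1 - y)^alpha at order k, that is,
    (-1)^k times the generalized binomial coefficient of alpha and k. *)
Fixpoint binomial_coeff (k : nat) : R :=
  if k is k'.+1 then binomial_coeff k' * (k'%:R - alpha) / k'.+1%:R else 1.

Local Notation e := binomial_coeff.

(** All coefficients but the constant one are nonpositive, so that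
    1 - (1 - y)^alpha has nonnegative coefficients. *)
Lemma binomial_coeffS_le0 k : e k.+1 <= 0.
Proof.
elim: k => [|k ih]; first by rewrite /= mul1r sub0r divr1 oppr_le0 ltW.
rewrite [e _]/= -/(e k.+1) mulr_le0_ge0 ?invr_ge0//.
rewrite mulr_le0_ge0// subr_ge0 (le_trans alpha_le1)//.
by rewrite ler1n.
Qed.

Lemma binomial_coeff_norm_le1 k : `|e k| <= 1.
Proof.
elim: k => [|k ih]; first by rewrite normr1.
rewrite /= -/(e k) -mulrA normrM -[leRHS]mul1r ler_pM//.
rewrite normrM normfV [`|k.+1%:R|]ger0_norm// ler_pdivrMr ?mul1r//.
have k0 : 0 <= k%:R :> R by [].
by rewrite ler_norml -natr1; apply/andP; split; move: alpha_gt0 alpha_le1; lra.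
Qed.

Lemma binomial_diffsE k : pseries_diffs e k = (k%:R - alpha) * e k.
Proof. by rewrite /pseries_diffs/=; field; rewrite addrC natr1. Qed.

Lemma binomial_diffs_norm_le1 k : `|pseries_diffs e k| <= 1.
Proof.
elim: k => [|k ih].
  by rewrite binomial_diffsE sub0r mulr1 normrN ger0_norm// ltW.
have -> : pseries_diffs e k.+1 =
    pseries_diffs e k * ((k.+1%:R - alpha) / k.+1%:R).
  by rewrite binomial_diffsE/= /pseries_diffs/=; field; rewrite addrC natr1.
rewrite normrM -[leRHS]mul1r ler_pM//.
rewrite normrM normfV [`|k.+1%:R|]ger0_norm// ler_pdivrMr ?mul1r//.
have k0 : 0 <= k%:R :> R by [].
by rewrite ler_norml -natr1; apply/andP; split; move: alpha_gt0 alpha_le1; lra.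
Qed.

(** Each of the k+1 terms 1, s, ..., s^k of the geometric series is at least
    s^k. *)
Lemma natrS_mul_expr_le (s : R) k : 0 <= s < 1 ->
  k.+1%:R * s ^+ k <= (1 - s)^-1.
Proof.
move=> /andP[s0 s1].
have -> : (1 - s)^-1 = limn (series (geometric 1 s)).
  by rewrite (cvg_lim _ (cvg_geometric_series _)) ?ger0_norm// mul1r.
apply: (@le_trans _ _ (series (geometric 1 s) k.+1)).
  rewrite /series/= big_mkord mulr_natl -[X in _ *+ X]card_ord -sumr_const.
  apply: ler_sum => i _; rewrite mul1r; apply: ler_wiXn2l => //; first exact: ltW.
  by rewrite -ltnS.
apply: nondecreasing_cvgn_le.
  by apply: nondecreasing_series => i _ _; rewrite /= mul1r exprn_ge0.
by apply: is_cvg_geometric_series; rewrite ger0_norm.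
Qed.

Lemma is_cvg_pseries_linear (c : nat -> R) (s : R) : 0 <= s < 1 ->
  (forall k, `|c k| <= k.+1%:R) -> cvgn (pseries c (s * s)).
Proof.
move=> s01 ck; have /andP[s0 s1] := s01.
apply: normed_cvg.
apply: (@series_le_cvg _ _ (geometric (1 - s)^-1 s)) => [n|n|n|] //=.
- by rewrite mulr_ge0 ?exprn_ge0// invr_ge0 subr_ge0 ltW.
- rewrite normrM normrX [`|s * s|]ger0_norm ?mulr_ge0// exprMn.
  apply: (@le_trans _ _ (n.+1%:R * s ^+ n * s ^+ n)).
    by rewrite -mulrA ler_wpM2r// ?mulr_ge0 ?exprn_ge0.
  by rewrite ler_wpM2r ?exprn_ge0// natrS_mul_expr_le.
- by apply: is_cvg_geometric_series; rewrite ger0_norm.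
Qed.

Let F (y : R) := limn (pseries e y).
Let F' (y : R) := limn (pseries (pseries_diffs e) y).

(** The radius K is the square of the midpoint of y and 1: it exceeds y, as
   ((1 + y) / 2)^2 - y = ((1 - y) / 2)^2. *)
Let radius (y : R) : 0 <= y < 1 -> exists2 K : R, `|y| < `|K| &
  [/\ cvgn (pseries e K), cvgn (pseries (pseries_diffs e) K) &
   cvgn (pseries (pseries_diffs (pseries_diffs e)) K)].
Proof.
move=> /andP[y0 y1]; pose s := (1 + y) / 2; exists (s * s).
  rewrite !ger0_norm ?mulr_ge0//; rewrite /s; nra.
have s01 : 0 <= s < 1 by apply/andP; split; rewrite /s; lra.
split; apply: is_cvg_pseries_linear => // k.
- by rewrite (le_trans (binomial_coeff_norm_le1 k))// ler1n.
- by rewrite (le_trans (binomial_diffs_norm_le1 k))// ler1n.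
- rewrite [X in `|X|]/pseries_diffs normrM ger0_norm// -[leRHS]mulr1.
  by rewrite ler_wpM2l// binomial_diffs_norm_le1.
Qed.

Lemma is_cvg_binomial_series (y : R) : 0 <= y < 1 -> cvgn (pseries e y).
Proof. by move=> /radius[K yK [cK _ _]]; exact: is_cvg_pseries_inside cK yK. Qed.

Let F_derive (y : R) : 0 <= y < 1 -> is_derive y (1 : R) F (F' y).
Proof. by move=> /radius[K yK [cK cK' cK'']]; exact: pseries_snd_diffs cK'' yK. Qed.

(** The differential equation of (1 - y)^alpha. *)
Let F_ode (y : R) : 0 <= y < 1 -> (1 - y) * F' y = - alpha * F y.
Proof.
move=> y01; have [K yK [cK cK' cK'']] := radius y01.
have cy := is_cvg_pseries_inside cK yK.
have cy' := is_cvg_pseries_inside cK' yK.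
have h := @pseries_diffs_equiv _ e y cy'; rewrite -/(F' y) in h.
have : pseries (pseries_diffs e) y n @[n --> \oo] --> y * F' y - alpha * F y.
  rewrite (_ : (fun n => _) = (fun n =>
    y * (series (fun i => i%:R * e i * y ^+ i.-1) n) - alpha * pseries e y n)).
    apply: cvgB; apply: cvgM => //; exact: cvg_cst.
  apply/funext => n; rewrite /pseries /series /= !mulr_sumr -sumrB.
  apply: eq_bigr => i _; rewrite binomial_diffsE.
  by case: i => [|i]; rewrite /= ?exprS; ring.
move=> /(cvg_lim (@Rhausdorff R)); rewrite -/(F' y) => E.
by rewrite mulrBl mul1r {1}E; ring.
Qed.

(** The function F y * (1 - y)^(- alpha), shown to be constant. *)
Let G (y : R) := F y * expR (- alpha * ln (1 - y)).

Let G_derive (y : R) : 0 <= y < 1 -> is_derive y (1 : R) G 0.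
Proof.
move=> y01; have /andP[y0 y1] := y01.
have y1' : 0 < 1 - y by rewrite subr_gt0.
have dF := F_derive y01.
have dl : is_derive (1 - y) (1 : R) (@ln R) (1 - y)^-1 by exact: is_derive1_ln.
have d1 : is_derive y (1 : R) (fun y : R => 1 - y) (-1).
  have := is_deriveB (is_derive_cst (1 : R) y 1) (is_derive_id y (1 : R)).
  by rewrite sub0r.
have d2 := @is_derive1_comp R (@ln R) (fun y => 1 - y) y _ _ dl d1.
have d3 := is_deriveZ (- alpha) d2.
have d4 := @is_derive1_comp R (@expR R) _ y _ _
  (is_derive_expR (- alpha * ln (1 - y))) d3.
have d5 := is_deriveM dF d4.
apply: is_derive_eq d5 _; rewrite /GRing.scale/=.
set E := expR _.
have -> : F' y = (- alpha * F y) / (1 - y).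
  by rewrite -F_ode// mulrAC divff ?mul1r// gt_eqF.
by field; rewrite gt_eqF.
Qed.

Lemma binomial_seriesE (y : R) : 0 <= y < 1 ->
  limn (pseries e y) = (1 - y) `^ alpha.
Proof.
move=> y01; have /andP[y0 y1] := y01.
have GE : G y = 1.
  have G0 : G 0 = 1.
    rewrite /G subr0 ln1 mulr0 expR0 mulr1 /F.
    apply: (@cvg_lim _ (@Rhausdorff R)); rewrite -cvg_shiftS.
    rewrite (_ : (fun n => _) = cst 1); first exact: cvg_cst.
    apply/funext => n; rewrite /pseries /series /= big_nat_recl//= mul1r.
    by rewrite expr0 big1 ?addr0// => i _; rewrite expr0n mulr0.
  have [->//|yn0] := eqVneq y 0.
  have y0' : 0 < y by rewrite lt_neqAle eq_sym yn0.
  have [||c _] := @MVT R G (fun=> 0) 0 y y0'.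
  - move=> x; rewrite in_itv/= => /andP[x0 xy]; apply: G_derive.
    by rewrite ltW//= (lt_trans xy).
  - apply: derivable_within_continuous => x; rewrite in_itv/= => /andP[x0 xy].
    by apply: ex_derive; apply: G_derive; rewrite x0/= (le_lt_trans xy).
  by rewrite mul0r G0 => /eqP; rewrite subr_eq0 => /eqP.
have y1' : 0 < 1 - y by rewrite subr_gt0.
rewrite /powR gt_eqF//; move: GE; rewrite /G /F mulNr expRN => GE.
by rewrite -[LHS](@mulfVK _ (expR (alpha * ln (1 - y))))// ?GE ?mul1r// gt_eqF ?expR_gt0.
Qed.

End binomial_series.

(** * Stable characteristic functions *)

Section stable.
Context {R : realType}.

Lemma cvgn_powR (u : nat -> R) (l r : R) : 0 < r -> (forall n, 0 <= u n) ->
  u n @[n --> \oo] --> l -> u n `^ r @[n --> \oo] --> l `^ r.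
Proof.
move=> r0 u0 ul.
have l0 : 0 <= l.
  rewrite -(cvg_lim _ ul)//; apply: limr_ge; first by apply: cvgP ul.
  by near=> n; exact: u0.
move: l0 ul; rewrite le_eqVlt => /predU1P[<-|l0] ul.
  rewrite powR0 ?gt_eqF//; apply/cvgr0Pnorm_lt => eps eps0.
  have d0 : 0 < eps `^ r^-1 by exact: powR_gt0.
  near=> n; have un : `|u n| < eps `^ r^-1.
    by near: n; exact: (cvgr0Pnorm_lt _).1 ul _ d0.
  move: un; rewrite !ger0_norm ?powR_ge0// => un.
  have := gt0_ltr_powR r0 (u0 n) (ltW d0) un.
  by rewrite -powRrM mulVf ?gt_eqF// powRr1 ?ltW.
have cl : {for l, continuous (fun x : R => x `^ r)}.
  apply: differentiable_continuous; apply/derivable1_diffP.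
  by apply: derivable_powR; rewrite in_itv/= l0.
exact: (cvg_comp _ _ ul cl).
Unshelve. all: by end_near. Qed.

Lemma cvgn_expR (u : nat -> R) (l : R) :
  u n @[n --> \oo] --> l -> expR (u n) @[n --> \oo] --> expR l.
Proof. by move=> ul; exact: (cvg_comp _ _ ul (@continuous_expR _ l)). Qed.

Lemma expR_npowR_le1 (mu z : R) (a : R) : 0 <= mu -> `|expR (- mu * z `^ a)| <= 1.
Proof.
move=> mu0; rewrite ger0_norm ?expR_ge0// -expR0 ler_expR mulNr oppr_le0.
by rewrite mulr_ge0// powR_ge0.
Qed.

(** Expand exp (- mu) exp (mu (1 - (1 - y)^alpha)) with y = r cos^2 (t x): both
    the exponential and 1 - (1 - y)^alpha have nonnegative coefficients. *)
Lemma cos_cone_binomial (mu t alpha r : R) : 0 <= mu -> 0 < alpha <= 1 ->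
  0 <= r < 1 ->
  cos_cone (fun x : R => expR (- mu * (1 - r * cos (t * x) ^+ 2) `^ alpha)).
Proof.
move=> mu0 /andP[a0 a1] r01; have /andP[r0 r1] := r01.
pose c k := if k is k'.+1 then - binomial_coeff alpha k else 0.
have cE y n : pseries c y n.+1 = 1 - pseries (binomial_coeff alpha) y n.+1.
  rewrite /pseries /series /= !big_nat_recl//= mul0r add0r mul1r expr0.
  by rewrite opprD addrA subrr add0r -sumrN; apply: eq_bigr => i _; rewrite mulNr.
have c0 k : 0 <= c k.
  by case: k => // k; rewrite /c oppr_ge0; exact: binomial_coeffS_le0.
have cvgc y : 0 <= y < 1 ->
    pseries c y n @[n --> \oo] --> 1 - (1 - y) `^ alpha.
  move=> y01; rewrite -(binomial_seriesE a0 a1)// -cvg_shiftS.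
  under eq_fun do rewrite cE.
  apply: cvgB; first exact: cvg_cst.
  by rewrite (@cvg_shiftS _ (pseries (binomial_coeff alpha) y)); apply: is_cvg_binomial_series.
have ycos x : 0 <= r * cos (t * x) ^+ 2 <= r.
  by rewrite mulr_ge0 ?sqr_ge0//= -[leRHS]mulr1 ler_wpM2l.
have cy : cos_cone (fun x => r * cos (t * x) ^+ 2).
  by apply: cos_coneZ => //; apply: cos_coneX; exact: cos_cone_cos.
have cp : cos_cone (fun x => limn (pseries c (r * cos (t * x) ^+ 2))).
  apply: (cos_cone_pseries (M := r)) => //.
    by move=> x; have /andP[h1 h2] := ycos x; rewrite ger0_norm.
  by apply: cvgP; exact: cvgc.
have := cos_cone_expR (cos_coneZ mu0 cp).
move=> /(cos_coneZ (expR_ge0 (- mu))) ce; apply: (cos_cone_eq ce) => x /=.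
rewrite -expRD; congr expR.
have /cvgc/(cvg_lim (@Rhausdorff R)) -> : 0 <= r * cos (t * x) ^+ 2 < 1.
  by have /andP[h1 h2] := ycos x; rewrite h1 (le_lt_trans h2).
ring.
Qed.

Lemma cvgn_harmonic1B : (1 - (@harmonic R) n) @[n --> \oo] --> (1 : R).
Proof.
rewrite -[X in _ --> X]subr0; apply: cvgB; [exact: cvg_cst|exact: cvg_harmonic].
Qed.

(** The previous lemma with alpha = p/2, in the limit r -> 1, since
    (1 - cos^2)^(p/2) = |sin|^p. *)
Lemma cos_cone_sin (mu t p : R) : 0 <= mu -> 0 < p <= 2 ->
  cos_cone (fun x : R => expR (- mu * `|sin (t * x)| `^ p)).
Proof.
move=> mu0 /andP[p0 p2].
have p01 : 0 < p / 2 <= 1 by apply/andP; split; lra.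
have har01 n : 0 < (@harmonic R) n <= 1.
  by rewrite harmonic_gt0/= invf_le1// ler1n.
pose f n x : R := expR (- mu *
  (1 - (1 - (@harmonic R) n) * cos (t * x) ^+ 2) `^ (p / 2)).
apply: (@cos_cone_lim _ f _ 1) => [n|n x|x].
- apply: cos_cone_binomial => //.
  by have /andP[h1 h2] := har01 n; rewrite subr_ge0 h2/= ltrBlDr ltrDl.
- exact: expR_npowR_le1.
apply: cvgn_expR.
apply: cvgM; first exact: cvg_cst.
have -> : `|sin (t * x)| `^ p = (1 - 1 * cos (t * x) ^+ 2) `^ (p / 2).
  rewrite mul1r -(sin2cos2 (t * x)) -real_normK ?num_real// -powR_mulrn//.
  by rewrite -powRrM; congr (_ `^ _); field.
apply: cvgn_powR; first by case/andP : p01.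
  move=> n; rewrite subr_ge0.
  have /andP[h1 h2] := har01 n.
  by rewrite -[leRHS]mulr1 ler_pM ?sqr_ge0 ?subr_ge0// gerBl ltW.
apply: cvgB; first exact: cvg_cst.
apply: cvgM; [exact: cvgn_harmonic1B|exact: cvg_cst].
Qed.

Lemma cvgn_diff_quotient0 (f : R -> R) (df : R) : is_derive (0 : R) (1 : R) f df ->
  (f ((@harmonic R) n) - f 0) / (@harmonic R) n @[n --> \oo] --> df.
Proof.
move=> d; have dd : derivable f 0 1 by exact: ex_derive.
have lE : 'D_1 f 0 = df by exact: derive_val.
have h : (fun h : R => h^-1 *: (f (h *: 1 + 0) - f 0)) @ 0^' --> df.
  by rewrite -[X in _ --> X]lE; exact: dd.
have har : harmonic n @[n --> \oo] --> (0 : R)^'.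
  move=> A A0.
  have /(@cvg_harmonic R) : nbhs (0 : R) (fun h => h != 0 -> A h) by [].
  by apply: (@filterS _ \oo) => n /=; apply; rewrite gt_eqF ?harmonic_gt0.
have := cvg_comp _ _ har h; apply: cvg_trans; apply: near_eq_cvg.
by near=> n; rewrite /= addr0 /GRing.scale/= mulr1 mulrC.
Unshelve. all: by end_near. Qed.

Lemma cvgn_sin_div (x : R) :
  sin ((@harmonic R) n * x) / (@harmonic R) n @[n --> \oo] --> x.
Proof.
have d1 : is_derive (0 : R) (1 : R) (fun h : R => h * x) x.
  have := is_deriveM (is_derive_id (0 : R) (1 : R)) (is_derive_cst x (0 : R) (1 : R)).
  by rewrite scaler0 add0r /GRing.scale/= mulr1.
have := @is_derive1_comp R (@sin R) (fun h => h * x) 0 _ _ (is_derive_sin _) d1.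
rewrite mul0r cos0 mul1r => /cvgn_diff_quotient0; apply: cvg_trans.
by apply: near_eq_cvg; near=> n; rewrite /= mul0r sin0 subr0.
Unshelve. all: by end_near. Qed.

Lemma cvgn_onem_expR_div (u : R) :
  (1 - expR (- (@harmonic R) n * u)) / (@harmonic R) n @[n --> \oo] --> u.
Proof.
have d1 : is_derive (0 : R) (1 : R) (fun h : R => h * - u) (- u).
  have := is_deriveM (is_derive_id (0 : R) (1 : R)) (is_derive_cst (- u) (0 : R) (1 : R)).
  by rewrite scaler0 add0r /GRing.scale/= mulr1.
have := @is_derive1_comp R (@expR R) (fun h => h * - u) 0 _ _ (is_derive_expR _) d1.
rewrite mul0r expR0 mul1r => /cvgn_diff_quotient0 /cvgN; rewrite opprK.
apply: cvg_trans; apply: near_eq_cvg; near=> n.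
by rewrite /= mul0r expR0 !fctE -mulNr opprB mulrN mulNr.
Unshelve. all: by end_near. Qed.

(** This is the positive definiteness of the symmetric p-stable
    characteristic function; it follows from cos_cone_sin, since
    |sin (t x) / t|^p tends to |x|^p as t -> 0. *)
Lemma cos_cone_stable (lambda p : R) : 0 < lambda -> 0 < p <= 2 ->
  cos_cone (fun x : R => expR (- lambda * `|x| `^ p)).
Proof.
move=> l0 p02; have /andP[p0 _] := p02.
pose f n x : R := expR (- lambda *
  `|sin ((@harmonic R) n * x) / (@harmonic R) n| `^ p).
apply: (@cos_cone_lim _ f _ 1) => [n|n x|x].
- have h0 := @harmonic_gt0 R n.
  have mu0 : 0 <= lambda / (@harmonic R) n `^ p.
    by rewrite divr_ge0 ?powR_ge0// ltW.
  apply: (cos_cone_eq (cos_cone_sin ((@harmonic R) n) mu0 p02)) => x.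
  rewrite /f normrM powRM// [`|_^-1|]ger0_norm ?invr_ge0 ?ltW//.
  rewrite -[in RHS]powR_inv1 ?ltW// powRAC powR_inv1 ?powR_ge0//.
  by congr expR; rewrite mulrA -!mulNr mulrAC.
- by apply: expR_npowR_le1; exact: ltW.
apply: cvgn_expR.
apply: cvgM; first exact: cvg_cst.
by apply: cvgn_powR => //; apply: cvg_norm; exact: cvgn_sin_div.
Qed.

End stable.

(** * Bounded measurable functions *)

Section bounded_measurable.
Context {R : realType}.

(** Real-valued measurable functions bounded on the whole space. *)
Definition bounded_measurable d (T : measurableType d) (f : T -> R) : Prop :=
  measurable_fun setT f /\ exists M : R, forall x, `|f x| <= M.

Section closure.
Context {d} {T : measurableType d}.
Implicit Types f g : T -> R.

Lemma bounded_measurableD f g : bounded_measurable f -> bounded_measurable g ->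
  bounded_measurable (fun x => f x + g x).
Proof.
move=> [mf [M fM]] [mg [N gN]]; split; first exact: measurable_funD.
by exists (M + N) => x; rewrite (le_trans (ler_normD _ _))// lerD.
Qed.

Lemma bounded_measurableM f g : bounded_measurable f -> bounded_measurable g ->
  bounded_measurable (fun x => f x * g x).
Proof.
move=> [mf [M fM]] [mg [N gN]]; split; first exact: measurable_funM.
by exists (M * N) => x; rewrite normrM ler_pM.
Qed.

Lemma bounded_measurable_cst (c : R) : bounded_measurable (fun _ : T => c).
Proof. by split; [exact: measurable_cst|exists `|c|]. Qed.

Lemma bounded_measurable_indic (A : set T) :
  measurable A -> bounded_measurable (\1_A : T -> R).
Proof.
move=> mA; split; first exact: measurable_indic.
by exists 1 => x; rewrite indicE; case: (_ \in _); rewrite ?normr1 ?normr0.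
Qed.

Lemma bounded_measurable_sum (I : Type) (s : seq I) (Q : pred I)
    (f : I -> T -> R) : (forall i, bounded_measurable (f i)) ->
  bounded_measurable (fun x => \sum_(i <- s | Q i) f i x).
Proof.
move=> bf; elim: s => [|i s ih].
  rewrite (_ : (fun x => _) = (fun=> 0)); first exact: bounded_measurable_cst.
  by apply/funext => x; rewrite big_nil.
under eq_fun do rewrite big_cons.
by case: (Q i) => //; exact: bounded_measurableD.
Qed.

Lemma bounded_measurable_prod (I : Type) (s : seq I) (Q : pred I)
    (f : I -> T -> R) : (forall i, bounded_measurable (f i)) ->
  bounded_measurable (fun x => \prod_(i <- s | Q i) f i x).
Proof.
move=> bf; elim: s => [|i s ih].
  rewrite (_ : (fun x => _) = (fun=> 1)); first exact: bounded_measurable_cst.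
  by apply/funext => x; rewrite big_nil.
under eq_fun do rewrite big_cons.
by case: (Q i) => //; exact: bounded_measurableM.
Qed.

Lemma bounded_measurable_comp d' (T' : measurableType d') (h : T' -> T) f :
  measurable_fun setT h -> bounded_measurable f ->
  bounded_measurable (f \o h).
Proof.
by move=> mh [mf [M fM]]; split; [exact: measurableT_comp|exists M => x /=].
Qed.

Lemma bounded_measurable_integrable (P : {finite_measure set T -> \bar R}) f :
  bounded_measurable f -> P.-integrable setT (EFin \o f).
Proof.
move=> [mf [M fM]]; apply: measurable_bounded_integrable => //.
  by rewrite ltey_eq fin_num_measure.
exists M; split; first exact: num_real.
by move=> x Mx y _ /=; rewrite (le_trans (fM y))// ltW.
Qed.

End closure.

Lemma bounded_measurable_cos (t : R) : bounded_measurable (fun x : R => cos (t * x)).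
Proof.
split; first exact: cos_cone_measurable (cos_cone_cos t).
by exists 1 => x; rewrite ler_norml cos_geN1 cos_le1.
Qed.

Lemma bounded_measurable_sin (t : R) : bounded_measurable (fun x : R => sin (t * x)).
Proof.
split.
  apply: measurableT_comp; last exact: measurable_funM.
  by apply: continuous_measurable_fun; exact: continuous_sin.
by exists 1 => x; rewrite ler_norml sin_geN1 sin_le1.
Qed.

(** The sum counts the positive integers that are at most y. *)
Lemma sum_indic_truncn (y : R) (J : nat) : 0 <= y -> y < J%:R ->
  `|y - \sum_(0 <= j < J) (j.+1%:R <= y)%R%:R| <= 1.
Proof.
move=> y0 yJ.
have -> : \sum_(0 <= j < J) (j.+1%:R <= y)%R%:R = (Num.truncn y)%:R :> R.
  under eq_bigr do rewrite -truncn_gt_nat.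
  rewrite (big_cat_nat (n := Num.truncn y))//=; last first.
    by rewrite ltnW// truncn_lt_nat.
  rewrite (@eq_big_nat _ _ _ _ _ _ (fun=> 1)); last by move=> j /andP[_ ->].
  rewrite sumr_const_nat subn0 [X in _ + X]big1_seq ?addr0// => j.
  by rewrite mem_index_iota => /andP[_ /andP[jy _]]; rewrite ltnNge jy.
have /andP[h1 h2] := truncn_itv y0.
by rewrite -natr1 in h2; rewrite ler_norml; apply/andP; split; lra.
Qed.

(** A linear functional that is continuous for the uniform norm and vanishes
    on indicators vanishes on bounded measurable functions, which are uniform
    limits of step functions. Applied to the difference of two functionals, it
    plays the part of the monotone class theorem below. *)
Lemma bounded_functional_eq0 d (T : measurableType d) (L : (T -> R) -> R) (C : R) :
  (forall f g, bounded_measurable f -> bounded_measurable g ->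
     L (fun x => f x + g x) = L f + L g) ->
  (forall c f, bounded_measurable f -> L (fun x => c * f x) = c * L f) ->
  (forall f (M : R), bounded_measurable f -> (forall x, `|f x| <= M) ->
     `|L f| <= C * M) ->
  (forall A, measurable A -> L (\1_A) = 0) ->
  forall f, bounded_measurable f -> L f = 0.
Proof.
move=> LD LZ LC L1 f bf; have [mf [M fM]] := bf.
have Lsum (J : nat) (F : nat -> T -> R) : (forall j, bounded_measurable (F j)) ->
    L (fun x => \sum_(0 <= j < J) F j x) = \sum_(0 <= j < J) L (F j).
  move=> bF; elim: J => [|J ih].
    rewrite big_nil -[RHS](L1 set0)//; congr L; apply/funext => x.
    by rewrite big_nil indicE in_set0.
  rewrite big_nat_recr//= -ih -LD//; last exact: bounded_measurable_sum.
  by congr L; apply/funext => x; rewrite big_nat_recr.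
have M0 : 0 <= `|M| by [].
apply/eqP; rewrite -normr_le0; apply/ler_addgt0Pl => eps eps0.
rewrite addr0.
(* The step function with N+1 levels per unit is within 1 / (N+1) of f + |M|,
   which is nonnegative. *)
have [N NC] : exists N : nat, `|C| / eps < N.+1%:R.
  by exists (Num.truncn (`|C| / eps)); exact: truncnS_gt.
pose A j := [set x : T | j.+1%:R <= N.+1%:R * (f x + `|M|)].
have mA j : measurable (A j).
  rewrite -[A j]setTI; apply: (measurable_fun_le (f := fun=> j.+1%:R)) => //.
  apply: measurable_funM => //; exact: measurable_funD.
pose J := (Num.truncn (N.+1%:R * (`|M| + `|M|))).+1.
pose h x := \sum_(0 <= j < J) (\1_(A j) x : R).
have bA j : bounded_measurable (\1_(A j) : T -> R) := bounded_measurable_indic (mA j).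
have bh : bounded_measurable h by exact: bounded_measurable_sum.
have Lh : L h = 0 by rewrite Lsum// big1// => j _; exact: L1.
pose g x := N.+1%:R * (f x + `|M|).
have bfM : bounded_measurable (fun x => f x + `|M|).
  by apply: bounded_measurableD => //; exact: bounded_measurable_cst.
have Lg : L g = N.+1%:R * L f.
  rewrite LZ// LD//; last exact: bounded_measurable_cst.
  rewrite (_ : (fun=> `|M|) = (fun x => `|M| * (\1_setT x : R))).
    by rewrite LZ ?L1 ?mulr0 ?addr0//; exact: bounded_measurable_indic.
  by apply/funext => x; rewrite indicT mulr1.
have bg : bounded_measurable g.
  by apply: bounded_measurableM => //; exact: bounded_measurable_cst.
have bNh : bounded_measurable (fun x => -1 * h x).
  by apply: bounded_measurableM => //; exact: bounded_measurable_cst.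
have Lgh : L (fun x => g x + -1 * h x) = N.+1%:R * L f.
  by rewrite LD// (LZ _ h)// Lh mulr0 addr0.
have : `|L (fun x => g x + -1 * h x)| <= C * 1.
  apply: LC; first exact: bounded_measurableD.
  move=> x; rewrite mulN1r /h.
  have -> : \sum_(0 <= j < J) (\1_(A j) x : R) =
      \sum_(0 <= j < J) (j.+1%:R <= g x)%R%:R.
    apply: eq_bigr => j _; rewrite indicE; congr (_ %:R); congr nat_of_bool.
    by apply/idP/idP; rewrite inE.
  have /ler_normlP[f1 f2] := fM x.
  have Mn := ler_norm M.
  apply: sum_indic_truncn.
    by rewrite mulr_ge0//; lra.
  apply: le_lt_trans (truncnS_gt _).
  by rewrite ler_wpM2l//; lra.
rewrite Lgh normrM mulr1 ger0_norm// => h1.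
have h2 : `|C| < N.+1%:R * eps by rewrite -ltr_pdivrMr.
have h3 : C <= `|C| by exact: ler_norm.
have N0 : 0 < N.+1%:R :> R by [].
rewrite -(ler_pM2l N0); lra.
Qed.

End bounded_measurable.

(** * Expectations and independence *)

Section expectation.
Context {d} {T : measurableType d} {R : realType} (P : probability T R).

Lemma expectation_bmD (f g : T -> R) :
  bounded_measurable f -> bounded_measurable g ->
  \int[P]_w (f w + g w) = \int[P]_w f w + \int[P]_w g w.
Proof. by move=> bf bg; rewrite RintegralD//; exact: bounded_measurable_integrable. Qed.

Lemma expectation_bmB (f g : T -> R) :
  bounded_measurable f -> bounded_measurable g ->
  \int[P]_w (f w - g w) = \int[P]_w f w - \int[P]_w g w.
Proof. by move=> bf bg; rewrite RintegralB//; exact: bounded_measurable_integrable. Qed.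

Lemma expectation_bmZ (c : R) (f : T -> R) : bounded_measurable f ->
  \int[P]_w (c * f w) = c * \int[P]_w f w.
Proof. by move=> bf; rewrite RintegralZl//; exact: bounded_measurable_integrable. Qed.

Lemma expectation_bm_le (f : T -> R) (M : R) : bounded_measurable f ->
  (forall x, `|f x| <= M) -> `|\int[P]_w f w| <= M.
Proof.
move=> bf fM; have fi := bounded_measurable_integrable P bf.
apply: (le_trans (le_normr_Rintegral _ fi)) => //.
have -> : M = \int[P]_(w in setT) M by rewrite Rintegral_cst//= probability_setT/= mulr1.
apply: le_Rintegral => //; first exact: integrable_norm.
exact: bounded_measurable_integrable (bounded_measurable_cst M).
Qed.

Lemma expectation_bm_cst (c : R) : \int[P]_(w in setT) c = c.
Proof. by rewrite Rintegral_cst//= probability_setT/= mulr1. Qed.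

Lemma expectation_indicE (A : set T) : measurable A ->
  \int[P]_w (\1_A w) = fine (P A).
Proof. by move=> mA; rewrite /Rintegral integral_indic// setIT. Qed.

Lemma indep_indic n (X : 'I_n -> {RV P >-> R}) (B : 'I_n -> set R) :
  mutually_independent X -> (forall i, measurable (B i)) ->
  \int[P]_w (\prod_(i < n) (\1_(B i) (X i w) : R)) =
  \prod_(i < n) \int[P]_w (\1_(B i) (X i w)).
Proof.
move=> indep mB.
have mX i : measurable (X i @^-1` B i).
  by rewrite -[X in measurable X]setTI; exact: measurable_funP.
have mI : measurable (\bigcap_(i in [set` [set: 'I_n]%SET]) (X i @^-1` B i)).
  by apply: fin_bigcap_measurable => //; exact: finite_finset.
transitivity (fine (P (\bigcap_(i in [set` [set: 'I_n]%SET]) (X i @^-1` B i)))).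
  rewrite -expectation_indicE//; apply: eq_Rintegral => w _.
  rewrite [RHS]indicE; have [/set_mem wI|/negP wI] := boolP (w \in _).
    rewrite big1// => i _; rewrite indicE mem_set//.
    by apply: (wI i) => /=; rewrite inE.
  have [i wi] : exists i, ~ B i (X i w).
    apply/existsNP => wB; apply: wI; rewrite inE => i _; exact: wB.
  by rewrite (bigD1 i)//= indicE memNset// mul0r.
rewrite indep//.
under eq_bigl do rewrite inE.
under eq_bigr => i _ do rewrite -(fineK (fin_num_measure P _ (mX i))).
rewrite prodEFin /=; apply: eq_bigr => i _.
by rewrite -expectation_indicE.
Qed.

(** The family g with its k-th member replaced by f. *)
Definition update n (g : 'I_n -> R -> R) (k : 'I_n) (f : R -> R) (i : 'I_n) :=
  if i == k then f else g i.

Lemma bounded_measurable_RV (X : {RV P >-> R}) (g : R -> R) :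
  bounded_measurable g -> bounded_measurable (fun w => g (X w)).
Proof. by apply: bounded_measurable_comp; exact: measurable_funPT. Qed.

(** Independence on events extends to bounded measurable functions, one
    coordinate at a time. *)
Lemma indep_prod n (X : 'I_n -> {RV P >-> R}) (g : 'I_n -> R -> R) :
  mutually_independent X -> (forall i, bounded_measurable (g i)) ->
  \int[P]_w (\prod_(i < n) g i (X i w)) =
  \prod_(i < n) \int[P]_w g i (X i w).
Proof.
move=> indep bg.
(* Induction on k: the functions of index at least k are indicators. *)
suff H k (h : 'I_n -> R -> R) : (forall i, bounded_measurable (h i)) ->
    (forall i : 'I_n, (k <= i)%N ->
      exists2 B : set R, measurable B & h i = \1_B) ->
    \int[P]_w (\prod_(i < n) h i (X i w)) = \prod_(i < n) \int[P]_w h i (X i w).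
  by apply: (H n) => // i; rewrite leqNgt ltn_ord.
elim: k h => [|k ih] h bh hB.
  have /choice[B hB'] : forall i, exists B : set R, measurable B /\ h i = \1_B.
    by move=> i; have [//|B mB ->] := hB i; exists B.
  under eq_Rintegral => w _ do under eq_bigr => i _ do rewrite (hB' i).2.
  rewrite indep_indic//; last by move=> i; exact: (hB' i).1.
  by apply: eq_bigr => i _; rewrite (hB' i).2.
have [nk|kn] := leqP n k.
  by apply: ih => // i ki; have := leq_trans nk ki; rewrite leqNgt ltn_ord.
pose j := Ordinal kn.
pose Z w := \prod_(i < n | i != j) h i (X i w).
pose c := \prod_(i < n | i != j) \int[P]_w h i (X i w).
have bZ : bounded_measurable Z.
  by apply: bounded_measurable_prod => i; exact: bounded_measurable_RV.
have [_ [MZ ZM]] := bZ.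
pose L (f : R -> R) := \int[P]_w (f (X j w) * Z w) - \int[P]_w f (X j w) * c.
suff L0 : L (h j) = 0.
  move/eqP: L0; rewrite subr_eq0 => /eqP L0.
  by rewrite (bigD1 j)//= -L0; apply: eq_Rintegral => w _; rewrite (bigD1 j).
have bfX (f : R -> R) : bounded_measurable f -> bounded_measurable (fun w => f (X j w)).
  exact: bounded_measurable_RV.
have bfZ (f : R -> R) : bounded_measurable f ->
    bounded_measurable (fun w => f (X j w) * Z w).
  by move=> bf; apply: bounded_measurableM => //; exact: bfX.
apply: (@bounded_functional_eq0 _ _ _ L (MZ + `|c|)) => //.
- move=> f1 f2 b1 b2; rewrite /L.
  under eq_Rintegral do rewrite mulrDl.
  by rewrite !expectation_bmD; first ring; do ?[exact: bfX|exact: bfZ].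
- move=> a f bf; rewrite /L.
  under eq_Rintegral do rewrite -mulrA.
  by rewrite !expectation_bmZ; first ring; do ?[exact: bfX|exact: bfZ].
- move=> f M bf fM; rewrite /L (le_trans (ler_normB _ _))//.
  rewrite mulrDl lerD//.
    apply: expectation_bm_le; first exact: bfZ.
    by move=> w; rewrite normrM mulrC ler_pM.
  rewrite normrM mulrC ler_wpM2l//.
  by apply: expectation_bm_le => //; exact: bfX.
- move=> A mA; rewrite /L; apply/eqP; rewrite subr_eq0; apply/eqP.
  pose h' := update h j (\1_A).
  have h'j : h' j = \1_A by rewrite /h' /update eqxx.
  have h'i i : i != j -> h' i = h i by rewrite /h' /update => /negbTE ->.
  have bh' i : bounded_measurable (h' i).
    by rewrite /h' /update; case: ifP => // _; exact: bounded_measurable_indic.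
  have := ih h' bh'.
  rewrite [in RHS](bigD1 j)//= h'j.
  under [X in _ * X]eq_bigr => i ij do rewrite h'i//.
  rewrite -/c => <-.
    apply: eq_Rintegral => w _; rewrite [in RHS](bigD1 j)//= h'j.
    by congr (_ * _); apply: eq_bigr => i ij; rewrite h'i.
  move=> i; rewrite leq_eqVlt => /predU1P[ki|ki].
    have -> : i = j by exact: val_inj.
    by exists A.
  rewrite h'i; first exact: hB.
  by apply: contraTneq ki => ->; rewrite ltnn.
Qed.

End expectation.

(** * Characteristic functions *)

Section density.
Context {d} {T : measurableType d} {R : realType} (P : probability T R).
Variables (X : {RV P >-> R}) (phi : R -> R).
Hypothesis Xphi : has_density X phi.
Local Notation mu := (@lebesgue_measure R).

(** The density is not assumed nonnegative: the law of X controls its integral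
    over the set where it is nonnegative and over the complement. *)
Lemma density_integrable : mu.-integrable setT (EFin \o phi).
Proof.
have [mphi dphi] := Xphi.
have mD B : measurable B -> measurable_fun B (EFin \o phi).
  by move=> mB; apply/measurable_EFinP; exact: measurable_funTS.
pose A := [set x | 0 <= phi x].
have mA : measurable A.
  by rewrite -[A]setTI; exact: (measurable_fun_le (f := fun=> 0)).
have mnA : measurable (~` A) by exact: measurableC.
apply/integrableP; split; first exact: mD.
rewrite -(setUv A) ge0_integral_setU//=; last 2 first.
- apply/measurable_EFinP; apply: measurableT_comp => //.
  exact: measurable_funTS.
- exact/disj_setPCl.
apply: lte_add_pinfty.
  have -> : (\int[mu]_(x in A) `|phi x|%:E = \int[mu]_(x in A) (phi x)%:E)%E.
    by apply: eq_integral => x /set_mem Ax /=; rewrite ger0_norm.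
  by rewrite -dphi// (le_lt_trans (probability_le1 _ _))// ltry.
have : (\int[mu]_(x in ~` A) (phi x)%:E = - \int[mu]_(x in ~` A) `|phi x|%:E)%E.
  rewrite -integral_ge0N//; apply: eq_integral => x /set_mem nAx.
  by rewrite -EFinN ltr0_norm ?opprK// ltNge; exact/negP.
rewrite -dphi// => /(congr1 -%E); rewrite oppeK => <-.
by rewrite (@le_lt_trans _ _ 0%E)// leeNl oppe0 measure_ge0.
Qed.

Lemma bounded_measurable_density (g : R -> R) : bounded_measurable g ->
  mu.-integrable setT (fun x => (g x * phi x)%:E).
Proof.
move=> [mg [M gM]].
have := @integrableMr _ _ _ mu setT measurableT g (EFin \o phi) mg _ density_integrable.
apply; exists M; split; first exact: num_real.
by move=> x Mx y _ /=; rewrite (le_trans (gM y))// ltW.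
Qed.

Lemma expectation_density (g : R -> R) : bounded_measurable g ->
  \int[P]_w g (X w) = \int[mu]_x (g x * phi x).
Proof.
move=> bg.
pose L (f : R -> R) := \int[P]_w f (X w) - \int[mu]_x (f x * phi x).
suff : L g = 0 by move/eqP; rewrite subr_eq0 => /eqP.
have bX (f : R -> R) : bounded_measurable f -> bounded_measurable (fun w => f (X w)).
  exact: bounded_measurable_RV.
have [mphi dphi] := Xphi.
have iphi := density_integrable.
apply: (@bounded_functional_eq0 _ _ _ L (1 + \int[mu]_x `|phi x|)) => //.
- move=> f1 f2 b1 b2; rewrite /L expectation_bmD; [|exact: bX..].
  under [X in _ - X]eq_Rintegral do rewrite mulrDl.
  rewrite RintegralD//; [ring|exact: bounded_measurable_density..].
- move=> a f bf; rewrite /L expectation_bmZ; last exact: bX.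
  under [X in _ - X]eq_Rintegral do rewrite -mulrA.
  rewrite RintegralZl//; [ring|exact: bounded_measurable_density].
- move=> f M bf fM; rewrite /L (le_trans (ler_normB _ _))//.
  rewrite mulrDl mul1r lerD//.
    by apply: expectation_bm_le => //; exact: bX.
  have ifphi := bounded_measurable_density bf.
  rewrite (le_trans (le_normr_Rintegral _ ifphi))//.
  rewrite -RintegralZr//; last exact: integrable_norm.
  apply: le_Rintegral => //.
  + exact: (@integrable_norm _ _ _ mu setT _ ifphi).
  + exact: integrableZr _ _ (integrable_norm iphi).
  + by move=> x _; rewrite normrM mulrC ler_wpM2l.
- move=> A mA; rewrite /L; apply/eqP; rewrite subr_eq0; apply/eqP.
  rewrite -[LHS]/(\int[P]_w (\1_(X @^-1` A) w)).
  rewrite expectation_indicE; last by apply: measurable_funPTI.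
  rewrite -[P _]/(distribution P X A) dphi// /Rintegral; congr fine.
  rewrite [LHS]integral_mkcond; apply: eq_integral => x _.
  by rewrite /patch indicE; case: ifPn => _; rewrite ?mul1r ?mul0r.
Qed.

Lemma fourierE (x : R) : fourier phi x =
  Complex (\int[mu]_y (cos (2 * pi * x * y) * phi y))
          (- \int[mu]_y (sin (2 * pi * x * y) * phi y)).
Proof.
rewrite /fourier /Cintegral /expi /=; congr Complex.
  by apply: eq_Rintegral => y _; rewrite cosN mul0r subr0 mulrC.
rewrite -mulN1r -RintegralZl//; last first.
  by apply: bounded_measurable_density; exact: bounded_measurable_sin.
by apply: eq_Rintegral => y _; rewrite sinN mul0r addr0; ring.
Qed.

Lemma expectation_cos (t : R) :
  \int[P]_w cos (t * X w) = complex.Re (fourier phi (t / (2 * pi))).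
Proof.
rewrite (expectation_density (bounded_measurable_cos t)) fourierE/=.
apply: eq_Rintegral => y _; congr (cos _ * _).
by rewrite mulrCA divff ?mulr1// gt_eqF// mulr_gt0// pi_gt0.
Qed.

Lemma expectation_sin (t : R) :
  \int[P]_w sin (t * X w) = - complex.Im (fourier phi (t / (2 * pi))).
Proof.
rewrite (expectation_density (bounded_measurable_sin t)) fourierE/= opprK.
apply: eq_Rintegral => y _; congr (sin _ * _).
by rewrite mulrCA divff ?mulr1// gt_eqF// mulr_gt0// pi_gt0.
Qed.

End density.

Section char_weighted_sum.
Context {d} {T : measurableType d} {R : realType} (P : probability T R).
Context {n : nat} (X : 'I_n -> {RV P >-> R}).

(** The characteristic function of a sum of independent symmetric variables
    is the product of theirs, in real form; symmetry is only used through the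
    vanishing of the sine transforms. *)
Lemma expectation_cos_sum (theta : 'I_n -> R) :
  mutually_independent X ->
  (forall i t, \int[P]_w sin (t * X i w) = 0) ->
  \int[P]_w cos (\sum_(i < n) theta i * X i w) =
  \prod_(i < n) \int[P]_w cos (theta i * X i w).
Proof.
move=> indep Esin0.
pose C s (g : 'I_n -> R -> R) w := cos (\sum_(i <- s) theta i * X i w) *
  \prod_(i < n | i \notin s) g i (X i w).
pose S s (g : 'I_n -> R -> R) w := sin (\sum_(i <- s) theta i * X i w) *
  \prod_(i < n | i \notin s) g i (X i w).
(* The induction on l adds theta i * X i to the angle for i in l; the
   functions g i, for i outside l, receive the cosine and sine of the next
   angle when the addition formulas split it off. *)
suff H : forall (l : seq 'I_n) (g : 'I_n -> R -> R), uniq l ->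
    (forall i, bounded_measurable (g i)) ->
    [/\ \int[P]_w C l g w = \prod_(i <- l) \int[P]_w cos (theta i * X i w) *
          \prod_(i < n | i \notin l) \int[P]_w g i (X i w) &
        \int[P]_w S l g w = 0].
  have [|+ _] := H (enum 'I_n) (fun _ => cst 1) (enum_uniq _).
    by move=> i; exact: bounded_measurable_cst.
  rewrite big_enum/= [X in _ * X]big_pred0 ?mulr1; last first.
    by move=> i; rewrite mem_enum.
  move=> <-; apply: eq_Rintegral => w _.
  rewrite /C big_enum/= [X in _ * X]big_pred0 ?mulr1// => i.
  by rewrite mem_enum.
have trig (h : R -> R) s (g : 'I_n -> R -> R) : bounded_measurable h ->
    (forall i, bounded_measurable (g i)) ->
    bounded_measurable (fun w => h (\sum_(i <- s) theta i * X i w) *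
      \prod_(i < n | i \notin s) g i (X i w)).
  move=> bh bg; apply: bounded_measurableM; last first.
    by apply: bounded_measurable_prod => i; exact: bounded_measurable_RV.
  apply: (bounded_measurable_comp (h := fun w => \sum_(i <- s) theta i * X i w)) bh.
  apply: measurable_sum => i; apply: measurable_funM => //.
have bcos : bounded_measurable (@cos R).
  by have := bounded_measurable_cos (1 : R); under eq_fun do rewrite mul1r.
have bsin : bounded_measurable (@sin R).
  by have := bounded_measurable_sin (1 : R); under eq_fun do rewrite mul1r.
elim=> [|k s ih] g.
  move=> _ bg; split.
    rewrite big_nil mul1r -(indep_prod indep bg).
    by apply: eq_Rintegral => w _; rewrite /C big_nil cos0 mul1r.
  rewrite -[RHS](expectation_bm_cst P 0); apply: eq_Rintegral => w _.
  by rewrite /S big_nil sin0 mul0r.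
rewrite cons_uniq => /andP[ks us] bg.
pose gc := update g k (fun x => cos (theta k * x)).
pose gs := update g k (fun x => sin (theta k * x)).
have bgc i : bounded_measurable (gc i).
  by rewrite /gc /update; case: ifP => // _; exact: bounded_measurable_cos.
have bgs i : bounded_measurable (gs i).
  by rewrite /gs /update; case: ifP => // _; exact: bounded_measurable_sin.
have [Cc Sc] := ih gc us bgc.
have [Cs Ss] := ih gs us bgs.
have predE i : (i \notin k :: s) = (i \notin s) && (i != k).
  by rewrite in_cons negb_or andbC.
have prodc w : \prod_(i < n | i \notin s) gc i (X i w) =
    cos (theta k * X k w) * \prod_(i < n | i \notin k :: s) g i (X i w).
  rewrite (bigD1 k)//= {1}/gc /update eqxx; congr (_ * _).
  rewrite (eq_bigl _ _ predE); apply: eq_bigr => i /andP[_ ik].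
  by rewrite /gc /update (negbTE ik).
have prods w : \prod_(i < n | i \notin s) gs i (X i w) =
    sin (theta k * X k w) * \prod_(i < n | i \notin k :: s) g i (X i w).
  rewrite (bigD1 k)//= {1}/gs /update eqxx; congr (_ * _).
  rewrite (eq_bigl _ _ predE); apply: eq_bigr => i /andP[_ ik].
  by rewrite /gs /update (negbTE ik).
have CE w : C (k :: s) g w = C s gc w - S s gs w.
  by rewrite /C /S big_cons cosD prodc prods; ring.
have SE w : S (k :: s) g w = C s gs w + S s gc w.
  by rewrite /C /S big_cons sinD prodc prods; ring.
split.
  under eq_Rintegral => w _ do rewrite CE.
  rewrite expectation_bmB; [|exact: trig..].
  rewrite Cc Ss subr0 big_cons (bigD1 k)//= {1}/gc /update eqxx.
  rewrite (eq_bigl _ _ predE) mulrCA -mulrA; congr (_ * (_ * _)).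
  apply: eq_bigr => i /andP[_ ik].
  by rewrite /gc /update (negbTE ik).
under eq_Rintegral => w _ do rewrite SE.
rewrite expectation_bmD; [|exact: trig..].
rewrite Cs Sc addr0 [X in _ * X](bigD1 k)//= {1}/gs /update eqxx.
by rewrite Esin0 mul0r mulr0.
Qed.

Lemma expectation_cos_weighted_sum (q : R) (phi : R -> R) :
  mutually_independent X -> (forall i, has_density (X i) phi) ->
  (forall x, complex.Im (fourier phi x) = 0) ->
  forall (a : 'rV[R]_n) (t : R),
  \int[P]_w cos (t * weighted_sum X q a w) =
  \prod_(i < n) complex.Re (fourier phi (t * a 0 i `^ q^-1 / (2 * pi))).
Proof.
move=> indep Xphi im0 a t.
under eq_Rintegral => w _.
  rewrite /weighted_sum mulr_sumr.
  under eq_bigr do rewrite mulrA.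
  over.
rewrite (expectation_cos_sum (fun i => t * a 0 i `^ q^-1))//.
  by apply: eq_bigr => i _; rewrite (expectation_cos (Xphi i)).
by move=> i s; rewrite (expectation_sin (Xphi i)) im0 oppr0.
Qed.

End char_weighted_sum.

(** * Log-convex functions *)

Section log_convexity.
Context {R : realType} {V : lmodType R} (C : set V).
Implicit Types f g : V -> R.

(** Hoelder's inequality for two terms, with exponents 1/l and 1/(1-l). *)
Lemma log_convexD f g : log_convex C f -> log_convex C g ->
  log_convex C (fun a => f a + g a).
Proof.
move=> [f0 cf] [g0 cg]; split=> [x Cx|x y l Cx Cy l01].
  by rewrite addr_ge0 ?f0 ?g0.
have /andP[l0 l1] := l01.
apply: (le_trans (lerD (cf _ _ _ Cx Cy l01) (cg _ _ _ Cx Cy l01))).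
have l10 : 0 < 1 - l by rewrite subr_gt0.
have := @hoelder2 R (f x `^ l) (g x `^ l) (f y `^ (1 - l)) (g y `^ (1 - l))
  l^-1 (1 - l)^-1 (powR_ge0 _ _) (powR_ge0 _ _) (powR_ge0 _ _) (powR_ge0 _ _).
rewrite !invr_gt0 !invrK => /(_ l0 l10).
rewrite subrKC => /(_ erefl) /le_trans; apply.
by rewrite -!powRrM !mulfV ?gt_eqF// !powRr1 ?f0 ?g0.
Qed.

Lemma log_convexZ (c : R) f : 0 <= c -> log_convex C f ->
  log_convex C (fun a => c * f a).
Proof.
move=> c0 [f0 cf]; split=> [x Cx|x y l Cx Cy l01].
  by rewrite mulr_ge0 ?f0.
have /andP[l0 l1] := l01.
rewrite !powRM ?f0// mulrACA -powRD; last first.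
  by rewrite subrKC oner_eq0.
by rewrite subrKC powRr1// ler_wpM2l// cf.
Qed.

Lemma log_convex_lim (f_ : nat -> V -> R) f : (forall n, log_convex C (f_ n)) ->
  (forall a, C a -> f_ n a @[n --> \oo] --> f a) ->
  (forall x y l, C x -> C y -> 0 < l < 1 -> C (l *: x + (1 - l) *: y)) ->
  log_convex C f.
Proof.
move=> cf ff Cconv.
split=> [x Cx|x y l Cx Cy l01].
  by apply: (ler_cvgn (cvg_cst 0) (ff x Cx)) => n; exact: (cf n).1.
have /andP[l0 l1] := l01.
apply: (ler_cvgn (ff _ (Cconv _ _ _ Cx Cy l01)) _) => [|n]; last first.
  exact: (cf n).2.
by apply: cvgM; apply: cvgn_powR; rewrite ?subr_gt0//;
  do ?[exact: ff|by move=> n; exact: (cf n).1].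
Qed.

Lemma log_convex_convex f (x y : V) (l : R) :
  log_convex C f -> C x -> C y -> 0 < l < 1 ->
  f (l *: x + (1 - l) *: y) <= l * f x + (1 - l) * f y.
Proof.
move=> [f0 cf] Cx Cy l01; have /andP[l0 l1] := l01.
have l10 : 0 < 1 - l by rewrite subr_gt0.
apply: (le_trans (cf _ _ _ Cx Cy l01)).
have := @conjugate_powR R (f x `^ l) (f y `^ (1 - l)) l^-1 (1 - l)^-1
  (powR_ge0 _ _) (powR_ge0 _ _).
rewrite !invr_gt0 !invrK subrKC => /(_ l0 l10 erefl) /le_trans; apply.
by rewrite -!powRrM !mulfV ?gt_eqF// !powRr1 ?f0// mulrC lerD2l mulrC.
Qed.

End log_convexity.

(** * Karamata's inequality *)

Section karamata.
Context {R : realType}.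
Variables (I : R -> Prop) (G : R -> R).
Hypothesis G_convex : forall a b c, I a -> I c -> a < b < c ->
  (c - a) * G b <= (c - b) * G a + (b - a) * G c.

Let slope (a b : R) := (G b - G a) / (b - a).

Let slopeC a b : slope a b = slope b a.
Proof. by rewrite /slope -(opprB a b) invrN mulrN -mulNr opprB. Qed.

Let slope_le_r a b c : I a -> I c -> a < b -> b <= c -> slope a b <= slope a c.
Proof.
move=> Ia Ic ab; rewrite le_eqVlt => /predU1P[->//|bc].
have := @G_convex a b c Ia Ic; rewrite ab bc => /(_ isT) h.
by rewrite /slope ler_pdivrMr ?subr_gt0// mulrAC ler_pdivlMr ?subr_gt0 ?(lt_trans ab)//; nra.
Qed.

Let slope_le_l a b c : I a -> I c -> a <= b -> b < c -> slope a c <= slope b c.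
Proof.
move=> Ia Ic + bc; rewrite le_eqVlt => /predU1P[->//|ab].
have := @G_convex a b c Ia Ic; rewrite ab bc => /(_ isT) h.
by rewrite /slope ler_pdivrMr ?subr_gt0 ?(lt_trans ab)// mulrAC ler_pdivlMr ?subr_gt0//; nra.
Qed.

Lemma chord_slope_le x y x' y' : I x -> I y -> I x' -> I y' ->
  x != y -> x' != y' -> x' <= x -> y' <= y -> slope x' y' <= slope x y.
Proof.
have slope_lt a b a' b' : I a -> I b -> I a' -> I b' ->
    a < b -> a' < b' -> a' <= a -> b' <= b -> slope a' b' <= slope a b.
  move=> Ia Ib Ia' Ib' ab ab' aa bb.
  by apply: (@le_trans _ _ (slope a' b)); [exact: slope_le_r|exact: slope_le_l].
move=> Ix Iy Ix' Iy'; case: (ltgtP x y) => // xy _; case: (ltgtP x' y') => // xy' _ xx yy.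
- exact: slope_lt.
- by rewrite (slopeC x'); apply: slope_lt => //; lra.
- by rewrite (slopeC x); apply: slope_lt => //; lra.
- by rewrite (slopeC x') (slopeC x); exact: slope_lt.
Qed.

(** D is the gap of the partial sums accumulated before the current index and c
   bounds the chord slopes from there on; this is Abel summation. Indices where
   x i = y i have no chord, and are skipped. *)
Let karamata_shifted n (x y : nat -> R) (D c : R) :
  (forall i, (i < n)%N -> I (x i) /\ I (y i)) ->
  (forall i j, (i <= j < n)%N -> x j <= x i /\ y j <= y i) ->
  (forall i, (i < n)%N -> x i != y i -> slope (x i) (y i) <= c) ->
  (forall k, (k <= n)%N -> 0 <= D + \sum_(i < k) (y i - x i)) ->
  D + \sum_(i < n) (y i - x i) = 0 ->
  0 <= c * D + \sum_(i < n) (G (y i) - G (x i)).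
Proof.
elim: n x y D c => [|n ih] x y D c Ixy dec slc part tot.
  by move: tot; rewrite !big_ord0 !addr0 => ->; rewrite mulr0.
have D0 : 0 <= D by have := part 0%N isT; rewrite big_ord0 addr0.
pose x' i := x i.+1; pose y' i := y i.+1.
have Ixy' i : (i < n)%N -> I (x' i) /\ I (y' i) by exact: (Ixy i.+1).
have dec' i j : (i <= j < n)%N -> x' j <= x' i /\ y' j <= y' i by exact: (dec i.+1 j.+1).
have part' k : (k <= n)%N -> 0 <= D + (y 0%N - x 0%N) + \sum_(i < k) (y' i - x' i).
  by move=> kn; have := part k.+1 kn; rewrite big_ord_recl addrA.
have tot' : D + (y 0%N - x 0%N) + \sum_(i < n) (y' i - x' i) = 0.
  by move: tot; rewrite big_ord_recl addrA.
rewrite big_ord_recl.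
have [xy|xy] := eqVneq (x 0%N) (y 0%N).
  rewrite xy subrr add0r; apply: (ih x' y') => //.
  - by move=> i ni; exact: slc.
  - by move=> k kn; have := part' k kn; rewrite xy subrr addr0.
  - by move: tot'; rewrite xy subrr addr0.
pose c' := slope (x 0%N) (y 0%N).
have c'c : c' <= c by exact: slc.
have -> : G (y 0%N) - G (x 0%N) = c' * (y 0%N - x 0%N).
  by rewrite /c' /slope divfK// subr_eq0 eq_sym.
have := ih x' y' (D + (y 0%N - x 0%N)) c' Ixy' dec' _ part' tot'.
have sl i : (i < n)%N -> x' i != y' i -> slope (x' i) (y' i) <= c'.
  move=> ni xyi; have [Ix Iy] := Ixy' i ni.
  have [Ix0 Iy0] := Ixy 0%N isT.
  have [xx yy] : x' i <= x 0%N /\ y' i <= y 0%N by exact: (dec 0%N i.+1).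
  exact: chord_slope_le.
move=> /(_ sl); rewrite /x' /y'.
set S := \sum_(_ < _) _ => h.
rewrite addrA; apply: le_trans h _; rewrite lerD2r mulrDr lerD2r.
by rewrite ler_wpM2r.
Qed.

(** Karamata's inequality for decreasingly ordered sequences. Chord
    slopes stand for derivatives, which may be infinite at an endpoint of I. *)
Lemma karamata n (x y : nat -> R) :
  (forall i, (i < n)%N -> I (x i) /\ I (y i)) ->
  (forall i j, (i <= j < n)%N -> x j <= x i /\ y j <= y i) ->
  (forall k, (k <= n)%N -> 0 <= \sum_(i < k) (y i - x i)) ->
  \sum_(i < n) (y i - x i) = 0 ->
  \sum_(i < n) G (x i) <= \sum_(i < n) G (y i).
Proof.
move=> Ixy dec part tot; rewrite -subr_ge0 -sumrB.
pose c := \sum_(i < n) `|slope (x i) (y i)|.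
have -> : \sum_(i < n) (G (y i) - G (x i)) =
    c * 0 + \sum_(i < n) (G (y i) - G (x i)) by rewrite mulr0 add0r.
apply: karamata_shifted => //.
- move=> i ni _; rewrite /c (bigD1 (Ordinal ni))//=.
  by rewrite (le_trans (ler_norm _))// lerDl sumr_ge0.
- by move=> k kn; rewrite add0r part.
- by rewrite add0r.
Qed.

End karamata.

(** * Products of log-convex and log-concave functions *)

Section products.
Context {R : realType} {n : nat}.

Lemma pos_orthant_convex (x y : 'rV[R]_n) (l : R) :
  pos_orthant x -> pos_orthant y -> 0 < l < 1 ->
  pos_orthant (l *: x + (1 - l) *: y).
Proof.
move=> x0 y0 /andP[l0 l1] i; rewrite !mxE.
by rewrite addr_gt0// mulr_gt0// subr_gt0.
Qed.

Lemma log_convex_prod (psi : R -> R) (s : R) : 0 < s ->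
  log_convex (V := R^o) [set t : R | 0 < t] psi ->
  log_convex (@pos_orthant R n) (fun a => \prod_(i < n) psi (s * a 0 i)).
Proof.
move=> s0 [psi0 cpsi]; split=> [x x0|x y l x0 y0 l01].
  by apply: prodr_ge0 => i _; apply: psi0 => /=; rewrite mulr_gt0.
have px i : 0 < s * x 0 i by rewrite mulr_gt0.
have py i : 0 < s * y 0 i by rewrite mulr_gt0.
have powR_prod (u : 'I_n -> R) (r : R) : (forall i, 0 <= u i) ->
    (\prod_(i < n) u i) `^ r = \prod_(i < n) u i `^ r.
  move=> u0; elim: (index_enum _) => [|i t ih]; first by rewrite !big_nil powR1.
  by rewrite !big_cons powRM ?ih//; apply: prodr_ge0.
rewrite !powR_prod; [|by move=> i; apply: psi0 (py i)|by move=> i; apply: psi0 (px i)].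
rewrite -big_split/=; apply: ler_prod => i _.
have pm : 0 < l * (s * x 0 i) + (1 - l) * (s * y 0 i).
  by have /andP[l0 l1] := l01; rewrite addr_gt0// mulr_gt0// subr_gt0.
have -> : s * (l *: x + (1 - l) *: y) 0 i =
    l * (s * x 0 i) + (1 - l) * (s * y 0 i) by rewrite !mxE; ring.
rewrite (psi0 _ pm)/=.
exact: (cpsi (s * x 0 i) (s * y 0 i) l (px i) (py i)).
Qed.

Lemma size_decreasing_rearrangement (x : 'rV[R]_n) :
  size (decreasing_rearrangement x) = n.
Proof. by rewrite /decreasing_rearrangement size_sort size_map size_enum_ord. Qed.

Lemma sum_decreasing_rearrangement (f : R -> R) (x : 'rV[R]_n) :
  \sum_(i < n) f (decreasing_rearrangement x)`_i = \sum_(i < n) f (x 0 i).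
Proof.
transitivity (\sum_(u <- decreasing_rearrangement x) f u).
  by rewrite (big_nth 0) size_decreasing_rearrangement big_mkord.
rewrite /decreasing_rearrangement (perm_big [seq x 0 i | i <- enum 'I_n])/=.
  by rewrite big_map big_enum.
by rewrite perm_sort.
Qed.

Lemma decreasing_rearrangement_sorted (x : 'rV[R]_n) i j : (i <= j < n)%N ->
  (decreasing_rearrangement x)`_j <= (decreasing_rearrangement x)`_i.
Proof.
move=> /andP[ij jn].
have : sorted >=%R (decreasing_rearrangement x).
  by apply: sort_sorted => a b; rewrite orbC; exact: le_total.
move=> /(sorted_leq_nth _ _ 0); apply.
- by move=> b a c /= ab bc; exact: le_trans bc ab.
- by move=> a /=.
- by rewrite inE size_decreasing_rearrangement (leq_ltn_trans ij).
- by rewrite inE size_decreasing_rearrangement.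
- by [].
Qed.

Lemma mem_decreasing_rearrangement (x : 'rV[R]_n) i : (i < n)%N ->
  exists k, (decreasing_rearrangement x)`_i = x 0 k.
Proof.
move=> ni; have : (decreasing_rearrangement x)`_i \in decreasing_rearrangement x.
  by rewrite mem_nth// size_decreasing_rearrangement.
by rewrite mem_sort => /mapP[k _ ->]; exists k.
Qed.

Lemma log_concave_gt0 (psi : R -> R) (a b u : R) :
  log_concave (V := R^o) [set t : R | 0 < t] psi ->
  0 < a -> 0 < psi a -> 0 < psi b -> a <= u <= b -> 0 < psi u.
Proof.
move=> [_ cpsi] a0 pa pb /andP[]; rewrite le_eqVlt => /predU1P[<-//|au].
rewrite le_eqVlt => /predU1P[->//|ub].
have ab : 0 < b - a by rewrite subr_gt0 (lt_trans au).
have b0 : 0 < b by rewrite (lt_trans a0)// (lt_trans au).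
pose l := (b - u) / (b - a).
have l01 : 0 < l < 1.
  apply/andP; split; first by rewrite divr_gt0// subr_gt0.
  by rewrite ltr_pdivrMr// mul1r; lra.
have := cpsi a b l a0 b0 l01.
have -> : l *: (a : R^o) + (1 - l) *: (b : R^o) = u.
  by rewrite /GRing.scale/= /l; field; rewrite gt_eqF.
by apply: lt_le_trans; rewrite mulr_gt0// powR_gt0.
Qed.

Lemma log_concave_ln (psi : R -> R) (a b c : R) :
  log_concave (V := R^o) [set t : R | 0 < t] psi ->
  0 < a /\ 0 < psi a -> 0 < c /\ 0 < psi c -> a < b < c ->
  (c - a) * - ln (psi b) <= (c - b) * - ln (psi a) + (b - a) * - ln (psi c).
Proof.
move=> cpsi [a0 pa] [c0 pc] /andP[ab bc].
have pb : 0 < psi b.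
  by apply: (log_concave_gt0 cpsi a0 pa pc); rewrite !ltW.
have ac : 0 < c - a by rewrite subr_gt0 (lt_trans ab).
pose l := (c - b) / (c - a).
have l01 : 0 < l < 1.
  apply/andP; split; first by rewrite divr_gt0// subr_gt0.
  by rewrite ltr_pdivrMr// mul1r; lra.
have := cpsi.2 a c l a0 c0 l01.
have -> : l *: (a : R^o) + (1 - l) *: (c : R^o) = b.
  by rewrite /GRing.scale/= /l; field; rewrite gt_eqF.
rewrite -ler_ln ?posrE ?mulr_gt0 ?powR_gt0//.
rewrite lnM ?posrE ?powR_gt0// !ln_powR => h.
have -> : (c - b) * - ln (psi a) + (b - a) * - ln (psi c) =
   (c - a) * - (l * ln (psi a) + (1 - l) * ln (psi c)).
  by rewrite /l; field; rewrite gt_eqF.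
by apply: ler_wpM2l; [exact: ltW|rewrite lerN2].
Qed.

(** If psi vanishes at some y_i there is nothing to prove. Otherwise psi is
    positive between the extreme y_i, hence at every x_i, and Karamata's
    inequality applies to - ln psi. *)
Lemma log_concave_prod_schur (psi : R -> R) :
  log_concave (V := R^o) [set t : R | 0 < t] psi ->
  schur_concave (@pos_orthant R n) (fun a => \prod_(i < n) psi (a 0 i)).
Proof.
move=> cpsi x y x0 y0 [part tot].
have psix0 i : 0 <= psi (x 0 i) by exact: (cpsi.1 _ (x0 i)).
have psiy0 i : 0 <= psi (y 0 i) by exact: (cpsi.1 _ (y0 i)).
have [/existsP[i /eqP yi]|/existsPn yN0] :=
    boolP [exists i : 'I_n, psi (y 0 i) == 0].
  by rewrite (bigD1 i)//= yi mul0r prodr_ge0.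
have psiy i : 0 < psi (y 0 i) by rewrite lt_neqAle eq_sym yN0 psiy0.
pose X := decreasing_rearrangement x; pose Y := decreasing_rearrangement y.
have totXY : \sum_(i < n) (Y`_i - X`_i) = 0.
  rewrite sumrB (sum_decreasing_rearrangement id) (sum_decreasing_rearrangement id).
  by rewrite tot subrr.
have partXY k : (k <= n)%N -> 0 <= \sum_(i < k) (Y`_i - X`_i).
  rewrite leq_eqVlt => /predU1P[->|kn]; first by rewrite totXY.
  case: k kn => [|k] kn; first by rewrite big_ord0.
  by rewrite sumrB subr_ge0 part.
have decXY i j : (i <= j < n)%N -> X`_j <= X`_i /\ Y`_j <= Y`_i.
  by move=> ij; split; exact: decreasing_rearrangement_sorted.
have YP i : (i < n)%N -> 0 < Y`_i /\ 0 < psi Y`_i.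
  by move=> /(mem_decreasing_rearrangement y)[k ->]; split.
have XP i : (i < n)%N -> 0 < X`_i /\ 0 < psi X`_i.
  move=> ni; have [k Xk] := mem_decreasing_rearrangement x ni.
  split; first by rewrite /X Xk.
  have n0 : (0 < n)%N by exact: leq_ltn_trans ni.
  have nn : (n.-1 < n)%N by rewrite prednK.
  have [ya pya] := YP _ nn; have [yb pyb] := YP _ n0.
  apply: (log_concave_gt0 cpsi ya pya pyb); apply/andP; split.
    have in1 : (i <= n.-1 < n)%N.
      by apply/andP; split=> //; rewrite -ltnS prednK.
    apply: (le_trans _ (decXY _ _ in1).1).
    move: totXY; rewrite -[in X in X -> _](prednK n0) big_ord_recr/= => /eqP.
    rewrite addrC addr_eq0 => /eqP h.
    have := partXY n.-1 (leq_pred n); lra.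
  have h := partXY 1%N n0; rewrite big_ord1 subr_ge0 in h.
  by rewrite (le_trans _ h)//; apply: (decXY 0%N i _).1.
have IXY i : (i < n)%N -> (0 < X`_i /\ 0 < psi X`_i) /\ (0 < Y`_i /\ 0 < psi Y`_i).
  by move=> ni; split; [exact: XP|exact: YP].
have := karamata (I := fun u => 0 < u /\ 0 < psi u) (G := fun u => - ln (psi u))
  (fun a b c => @log_concave_ln psi a b c cpsi) IXY decXY partXY totXY.
rewrite (sum_decreasing_rearrangement (fun u => - ln (psi u))).
rewrite (sum_decreasing_rearrangement (fun u => - ln (psi u))).
rewrite !sumrN lerN2 => lnxy.
have psix i : 0 < psi (x 0 i).
  have : x 0 i \in X by rewrite mem_sort map_f// mem_enum.
  move=> /(nthP 0)[k]; rewrite size_decreasing_rearrangement => kn <-.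
  exact: (XP k kn).2.
have prodE (z : 'rV[R]_n) : (forall i, 0 < psi (z 0 i)) ->
    \prod_(i < n) psi (z 0 i) = expR (\sum_(i < n) ln (psi (z 0 i))).
  by move=> z0; rewrite expR_sum; apply: eq_bigr => i _; rewrite lnK// posrE.
by rewrite !prodE// ler_expR.
Qed.

End products.

(** * Laplace transforms of weighted sums *)

Section expectation_closure.
Context {d} {T : measurableType d} {R : realType} (P : probability T R).

Lemma Rintegral_dominated_cvg (f_ : nat -> T -> R) (f g : T -> R) :
  (forall n, measurable_fun setT (f_ n)) ->
  (forall w, f_ n w @[n --> \oo] --> f w) ->
  P.-integrable setT (EFin \o g) ->
  (forall n w, `|f_ n w| <= g w) ->
  \int[P]_w f_ n w @[n --> \oo] --> \int[P]_w f w.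
Proof.
move=> mf_ ff ig fg.
have mf : measurable_fun setT f by apply: measurable_fun_cvg => // w _; exact: ff.
have [] := @dominated_convergence _ _ _ P setT measurableT
  (fun n => EFin \o f_ n) (EFin \o f) (EFin \o g).
- by move=> n; apply/measurable_EFinP.
- exact/measurable_EFinP.
- by apply: aeW => w _; apply: cvg_EFin; [exact: nearW|exact: ff].
- exact: ig.
- by apply: aeW => w n _; rewrite /= lee_fin.
move=> intf _ cf.
rewrite /Rintegral; apply: fine_cvg; rewrite fineK//.
exact: integrable_fin_num.
Qed.

(** A property of functions on V that is stable under sums, nonnegative
    multiples and pointwise limits holds for a |-> E f(S a), with f in the cone,
    as soon as it holds for a |-> E cos (t S a). *)
Lemma cos_cone_expectation (V : Type) (S : V -> T -> R)
    (Q : (V -> R) -> Prop) :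
  (forall a, measurable_fun setT (S a)) ->
  (forall t, Q (fun a => \int[P]_w cos (t * S a w))) ->
  (forall F G, Q F -> Q G -> Q (fun a => F a + G a)) ->
  (forall c F, 0 <= c -> Q F -> Q (fun a => c * F a)) ->
  (forall (F_ : nat -> V -> R) F, (forall n, Q (F_ n)) ->
     (forall a, F_ n a @[n --> \oo] --> F a) -> Q F) ->
  forall f, cos_cone f -> Q (fun a => \int[P]_w f (S a w)).
Proof.
move=> mS Qcos QD QZ Qlim f.
have bm h a : cos_cone h -> bounded_measurable (fun w => h (S a w)).
  move=> ch; apply: (bounded_measurable_comp (mS a) (f := h)).
  by split; [exact: cos_cone_measurable|exact: cos_cone_bounded].
elim=> {f} [t|f g cf Qf cg Qg|c f c0 cf Qf|f_ f M cf_ Qf fM ff].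
- exact: Qcos.
- rewrite (_ : (fun a => _) =
    (fun a => \int[P]_w f (S a w) + \int[P]_w g (S a w))); first exact: QD.
  by apply/funext => a; rewrite expectation_bmD//; exact: bm.
- rewrite (_ : (fun a => _) = (fun a => c * \int[P]_w f (S a w))); first exact: QZ.
  by apply/funext => a; rewrite expectation_bmZ//; exact: bm.
- apply: (Qlim (fun n a => \int[P]_w f_ n (S a w))) => // a.
  apply: (@Rintegral_dominated_cvg _ _ (fun=> M)) => //.
  + by move=> n; have [] := bm _ a (cf_ n).
  + exact: bounded_measurable_integrable (bounded_measurable_cst M).
Qed.

End expectation_closure.

Section weighted_sums.
Context {d} {T : measurableType d} {R : realType} (P : probability T R).
Context {n : nat} (X : 'I_n -> {RV P >-> R}).
Variables (q : R) (phi : R -> R).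

Lemma measurable_weighted_sum (a : 'rV[R]_n) :
  measurable_fun setT (weighted_sum X q a).
Proof. by apply: measurable_sum => i; exact: measurable_funM. Qed.

Lemma laplace_momentE (p lambda : R) (a : 'rV[R]_n) :
  laplace_moment X q p lambda a =
  \int[P]_w expR (- lambda * `|weighted_sum X q a w| `^ p).
Proof. by rewrite /laplace_moment unlock. Qed.

Lemma abs_momentE (p : R) (a : 'rV[R]_n) :
  abs_moment X q p a = \int[P]_w (`|weighted_sum X q a w| `^ p).
Proof. by rewrite /abs_moment unlock. Qed.

Hypotheses (q_gt0 : 0 < q) (indep : mutually_independent X).
Hypotheses (Xphi : forall i, has_density (X i) phi).
Hypothesis (phi_pos : forall x, 0 <= fourier phi x).

Let psi (t : R) := complex.Re (fourier phi (t `^ q^-1)).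

(** With s = (|t| / 2 pi)^q, the identity s^(1/q) a_i^(1/q) = (s a_i)^(1/q)
    turns each factor of the characteristic function into psi (s a_i). *)
Lemma expectation_cos_orthant (t : R) : t != 0 -> exists2 s, 0 < s &
  forall a : 'rV[R]_n, pos_orthant a ->
    \int[P]_w cos (t * weighted_sum X q a w) = \prod_(i < n) psi (s * a 0 i).
Proof.
move=> t0; have pi0 := @pi_gt0 R.
have s0 : 0 < `|t| / (2 * pi) by rewrite divr_gt0 ?mulr_gt0 ?normr_gt0.
exists ((`|t| / (2 * pi)) `^ q) => [|a a0]; first exact: powR_gt0.
have im0 x : complex.Im (fourier phi x) = 0.
  by have := phi_pos x; rewrite lecE => /andP[/eqP].
transitivity (\int[P]_w cos (`|t| * weighted_sum X q a w)).
  apply: eq_Rintegral => w _.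
  by have [//|_] := ger0P t; rewrite mulNr cosN.
rewrite (expectation_cos_weighted_sum q indep Xphi im0).
apply: eq_bigr => i _; rewrite /psi powRM ?powR_ge0 ?ltW//.
by rewrite -powRrM mulfV ?gt_eqF// powRr1 ?ltW// mulrAC.
Qed.

Lemma log_convex_laplace (p lambda : R) : 0 < p <= 2 -> 0 < lambda ->
  log_convex (V := R^o) [set t : R | 0 < t] psi ->
  log_convex (@pos_orthant R n) (laplace_moment X q p lambda).
Proof.
move=> p02 l0 cpsi.
rewrite (_ : laplace_moment X q p lambda = (fun a =>
  \int[P]_w expR (- lambda * `|weighted_sum X q a w| `^ p))); last first.
  by apply/funext => a; exact: laplace_momentE.
apply: (@cos_cone_expectation _ _ _ P _ (weighted_sum X q)
  (log_convex (@pos_orthant R n)) _ _ _ _ _ _ (cos_cone_stable l0 p02)).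
- exact: measurable_weighted_sum.
- move=> t.
  have cvx_eq (f g : 'rV[R]_n -> R) : (forall a, pos_orthant a -> f a = g a) ->
      log_convex (@pos_orthant R n) f -> log_convex (@pos_orthant R n) g.
    move=> fg [f0 cf]; split=> [a a0|a b l a0 b0 l01]; first by rewrite -fg ?f0.
    by rewrite -!fg// ?cf//; exact: pos_orthant_convex.
  have [->|t0] := eqVneq t 0.
    apply: (cvx_eq (fun=> 1)) => [a _|].
      under eq_Rintegral do rewrite mul0r cos0.
      by rewrite expectation_bm_cst.
    by split=> // a b l _ _ _; rewrite !powR1 mulr1.
  have [s s0 E] := expectation_cos_orthant t0.
  apply: (cvx_eq (fun a => \prod_(i < n) psi (s * a 0 i))) => [a a0|].
    by rewrite E.
  exact: log_convex_prod.
- exact: log_convexD.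
- by move=> c F c0; exact: log_convexZ.
- by move=> F_ F cF FF; apply: (log_convex_lim cF) => //; exact: pos_orthant_convex.
Qed.

Lemma schur_concave_laplace (p lambda : R) : 0 < p <= 2 -> 0 < lambda ->
  log_concave (V := R^o) [set t : R | 0 < t] psi ->
  schur_concave (@pos_orthant R n) (laplace_moment X q p lambda).
Proof.
move=> p02 l0 cpsi.
rewrite (_ : laplace_moment X q p lambda = (fun a =>
  \int[P]_w expR (- lambda * `|weighted_sum X q a w| `^ p))); last first.
  by apply/funext => a; exact: laplace_momentE.
apply: (@cos_cone_expectation _ _ _ P _ (weighted_sum X q)
  (schur_concave (@pos_orthant R n)) _ _ _ _ _ _ (cos_cone_stable l0 p02)).
- exact: measurable_weighted_sum.
- move=> t x y x0 y0 xy; have [->|t0] := eqVneq t 0.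
    under eq_Rintegral do rewrite mul0r cos0.
    by under [X in _ <= X]eq_Rintegral do rewrite mul0r cos0.
  have [s s0 E] := expectation_cos_orthant t0.
  rewrite (E x x0) (E y y0).
  apply: (@log_concave_prod_schur _ _ (fun u => psi (s * u)) _ x y x0 y0 xy).
  split=> [u u0|u v l u0 v0 l01]; first by apply: cpsi.1; exact: mulr_gt0.
  have := cpsi.2 (s * u) (s * v) l (mulr_gt0 s0 u0) (mulr_gt0 s0 v0) l01.
  by rewrite /GRing.scale/= mulrDr !(mulrCA s).
- by move=> F G cF cG x y x0 y0 xy; apply: lerD; [exact: cF|exact: cG].
- by move=> c F c0 cF x y x0 y0 xy; apply: ler_wpM2l => //; exact: cF.
- move=> F_ F cF FF x y x0 y0 xy.
  by apply: (ler_cvgn (FF y) (FF x)) => k; exact: cF.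
Qed.

End weighted_sums.

(** * Absolute moments of weighted sums *)

Section moments.
Context {d} {T : measurableType d} {R : realType} (P : probability T R).
Context {n : nat} (X : 'I_n.+1 -> {RV P >-> R}).
Variables (q : R) (phi : R -> R).
Hypothesis Xphi : forall i, has_density (X i) phi.

Lemma expectation_powR_same (p : R) i :
  (\int[P]_w (`|X i w| `^ p)%:E = \int[P]_w (`|X ord0 w| `^ p)%:E)%E.
Proof.
have E j : (\int[P]_w (`|X j w| `^ p)%:E =
    \int[distribution P (X j)]_x (`|x| `^ p)%:E)%E.
  rewrite /distribution ge0_integral_pushforward//=.
    apply/measurable_EFinP; apply: (measurableT_comp (measurable_powR p)).
    exact: normr_measurable.
rewrite !E; apply: eq_measure_integral => A mA _.
exact: (etrans ((Xphi i).2 A mA) (esym ((Xphi ord0).2 A mA))).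
Qed.

(** Bound every term by the largest one. *)
Lemma norm_sum_powR_le (p : R) (u : 'I_n.+1 -> R) : 0 <= p ->
  `|\sum_i u i| `^ p <= n.+1%:R `^ p * \sum_i `|u i| `^ p.
Proof.
move=> p0; pose k := [arg max_(i > (ord0 : 'I_n.+1)) `|u i|]%O.
have uk i : `|u i| <= `|u k| by rewrite /k; case: arg_maxP => // j _; apply.
have : `|\sum_i u i| <= n.+1%:R * `|u k|.
  rewrite (le_trans (ler_norm_sum _ _ _))// mulr_natl -[X in _ *+ X]card_ord.
  by rewrite -sumr_const; apply: ler_sum.
move=> uu; apply: (@le_trans _ _ ((n.+1%:R * `|u k|) `^ p)).
  by apply: ge0_ler_powR; rewrite ?nnegrE ?mulr_ge0.
by rewrite powRM// ler_wpM2l ?powR_ge0// (bigD1 k)//= lerDl sumr_ge0.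
Qed.

Lemma integrable_weighted_sum (p : R) (a : 'rV[R]_n.+1) : 0 < p ->
  ('E_P[(fun w => `|X ord0 w| `^ p)%R] < +oo)%E ->
  P.-integrable setT (EFin \o (fun w => `|weighted_sum X q a w| `^ p)).
Proof.
move=> p0 X0.
have mpow (f : T -> R) : measurable_fun setT f ->
    measurable_fun setT (fun w => `|f w| `^ p).
  move=> mf; apply: (measurableT_comp (measurable_powR p)).
  exact: measurableT_comp.
have iX i : P.-integrable setT (EFin \o (fun w => `|X i w| `^ p)).
  apply/integrableP; split; first by apply/measurable_EFinP; exact: mpow.
  under eq_integral do rewrite /= ger0_norm ?powR_ge0//.
  by rewrite expectation_powR_same; rewrite unlock in X0.
pose c i : R := `|a 0 i `^ q^-1| `^ p.
have ig : P.-integrable setT (fun w => ((n.+1%:R `^ p)%:E *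
    (\sum_(i < n.+1) ((c i)%:E * (`|X i w| `^ p)%:E)))%E).
  apply: integrableZl => //; apply: integrable_sum => // i _.
  exact: (integrableZl measurableT (c i) (iX i)).
apply: le_integrable ig => //.
  by apply/measurable_EFinP; apply: mpow; exact: measurable_weighted_sum.
move=> w _; under eq_bigr do rewrite -EFinM.
rewrite sumEFin -EFinM /= lee_fin ger0_norm ?powR_ge0// [leRHS]ger0_norm; last first.
  rewrite mulr_ge0 ?powR_ge0// sumr_ge0// => i _.
  by rewrite mulr_ge0 ?powR_ge0.
rewrite /weighted_sum (le_trans (norm_sum_powR_le _ (ltW p0)))//.
rewrite ler_wpM2l ?powR_ge0//; apply: ler_sum => i _.
by rewrite normrM powRM.
Qed.

(** The p-th absolute moment is minus the derivative at 0 of the Laplace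
    transform of |S|^p; the dominating function is |S|^p itself. *)
Lemma cvg_laplace_abs_moment (p : R) (a : 'rV[R]_n.+1) : 0 < p ->
  ('E_P[(fun w => `|X ord0 w| `^ p)%R] < +oo)%E ->
  (1 - laplace_moment X q p ((@harmonic R) k) a) / (@harmonic R) k
    @[k --> \oo] --> abs_moment X q p a.
Proof.
move=> p0 X0; rewrite abs_momentE.
pose u w := `|weighted_sum X q a w| `^ p.
have u0 w : 0 <= u w by exact: powR_ge0.
have iu := integrable_weighted_sum a p0 X0.
have mu : measurable_fun setT u.
  apply: (measurableT_comp (measurable_powR p)).
  by apply: measurableT_comp => //; exact: measurable_weighted_sum.
pose f k w : R := (1 - expR (- (@harmonic R) k * u w)) / (@harmonic R) k.
have h0 k := @harmonic_gt0 R k.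
have bexp k : bounded_measurable (fun w => expR (- (@harmonic R) k * u w)).
  split.
    by apply: measurableT_comp => //; exact: measurable_funM.
  by exists 1 => w; apply: expR_npowR_le1; exact: ltW.
rewrite (_ : (fun k => _) = (fun k => \int[P]_w f k w)).
  apply: (@Rintegral_dominated_cvg _ _ _ _ _ _ u) => //.
  - move=> k; apply: measurable_funM => //; apply: measurable_funB => //.
    exact: (bexp k).1.
  - by move=> w; exact: cvgn_onem_expR_div.
  - move=> k w; rewrite /f ger0_norm; last first.
      apply: divr_ge0; last exact: ltW.
      rewrite subr_ge0 -[leRHS]expR0 ler_expR mulNr oppr_le0.
      by apply: mulr_ge0 => //; exact: ltW.
    rewrite ler_pdivrMr//.
    by have := expR_ge1Dx (- (@harmonic R) k * u w); lra.
apply/funext => k; rewrite laplace_momentE /f.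
rewrite -[in LHS](expectation_bm_cst P 1) -expectation_bmB//; last first.
  exact: bounded_measurable_cst.
rewrite [LHS]mulrC -expectation_bmZ; last first.
  have := bounded_measurableD (bounded_measurable_cst 1)
    (bounded_measurableM (bounded_measurable_cst (-1)) (bexp k)).
  by under eq_fun do rewrite mulN1r.
by apply: eq_Rintegral => w _; rewrite mulrC.
Qed.

Let abs_moment_conv (p l : R) (x y : 'rV[R]_n.+1) : 0 < p ->
  ('E_P[(fun w => `|X ord0 w| `^ p)%R] < +oo)%E ->
  (forall lambda, 0 < lambda ->
    log_convex (@pos_orthant R n.+1) (laplace_moment X q p lambda)) ->
  pos_orthant x -> pos_orthant y -> 0 < l < 1 ->
  l * abs_moment X q p x + (1 - l) * abs_moment X q p y <=
    abs_moment X q p (l *: x + (1 - l) *: y).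
Proof.
move=> p0 X0 cL x0 y0 l01.
have cvg (a : 'rV[R]_n.+1) := @cvg_laplace_abs_moment p a p0 X0.
apply: (ler_cvgn (cvgD (cvgM (cvg_cst l) (cvg x)) (cvgM (cvg_cst (1 - l)) (cvg y)))
  (cvg (l *: x + (1 - l) *: y))) => k.
have h0 := @harmonic_gt0 R k.
rewrite /= !mulrA -mulrDl ler_pM2r ?invr_gt0//.
have := log_convex_convex (cL _ h0) x0 y0 l01.
move: (laplace_moment _ _ _ _ _) (laplace_moment _ _ _ _ x) => A B.
move: (laplace_moment _ _ _ _ _) => D; lra.
Qed.

Lemma concave_abs_moment (p : R) : 0 < p ->
  ('E_P[(fun w => `|X ord0 w| `^ p)%R] < +oo)%E ->
  (forall lambda, 0 < lambda ->
    log_convex (@pos_orthant R n.+1) (laplace_moment X q p lambda)) ->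
  concave_function (@pos_orthant R n.+1) (abs_moment X q p).
Proof.
move=> p0 X0 cL t x y /set_mem x0 /set_mem y0.
have [->|t0] := eqVneq t 0%:i01; first by rewrite !conv0.
have [->|t1] := eqVneq t 1%:i01; first by rewrite !conv1.
have l01 : 0 < t%:num < 1.
  apply/andP; split.
    by rewrite lt_neqAle ge0 andbT eq_sym; exact: t0.
  by rewrite lt_neqAle le1 andbT; exact: t1.
have := abs_moment_conv p0 X0 cL x0 y0 l01.
pose l := t%:num; rewrite -/l => key.
have -> : conv t (- abs_moment X q p x : R^o) (- abs_moment X q p y : R^o) =
    - (l * abs_moment X q p x + (1 - l) * abs_moment X q p y).
  by rewrite convRE -/l !mulrN -opprD.
by rewrite lerN2.
Qed.

Lemma schur_convex_abs_moment (p : R) : 0 < p ->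
  ('E_P[(fun w => `|X ord0 w| `^ p)%R] < +oo)%E ->
  (forall lambda, 0 < lambda ->
    schur_concave (@pos_orthant R n.+1) (laplace_moment X q p lambda)) ->
  schur_convex (@pos_orthant R n.+1) (abs_moment X q p).
Proof.
move=> p0 X0 cL x y x0 y0 xy.
have cvg (a : 'rV[R]_n.+1) := @cvg_laplace_abs_moment p a p0 X0.
apply: (ler_cvgn (cvg x) (cvg y)) => k.
have h0 := @harmonic_gt0 R k.
rewrite ler_pM2r; last by rewrite invr_gt0.
exact: (lerB (lexx 1) (cL _ h0 x y x0 y0 xy)).
Qed.

End moments.

(** * Log-convexity and Schur concavity *)

Theorem corollary1p2 (R : realType) (d : measure_display)
    (T : measurableType d) (P : probability T R) (n : nat)
    (X : 'I_n.+1 -> {RV P >-> R}) (q : R) (phi : R -> R)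
    (hq : 0 < q)
    (hindep : mutually_independent X)
    (hlaw : forall i, has_density (X i) phi)
    (heven : forall x, phi (- x) = phi x)
    (hint : Cintegrable (fourier phi))
    (hpos : forall x, 0 <= fourier phi x) :
  (log_convex (V := R^o) [set t : R | 0 < t]
     (fun t : R => complex.Re (fourier phi (t `^ q^-1))) ->
   (forall p lambda : R, 0 < p <= 2 -> 0 < lambda ->
      log_convex (@pos_orthant R n.+1) (laplace_moment X q p lambda)) /\
   (forall p : R, 0 < p <= 2 ->
      ('E_P[(fun w => `|X ord0 w| `^ p)%R] < +oo)%E ->
      concave_function (@pos_orthant R n.+1) (abs_moment X q p))) /\
  (log_concave (V := R^o) [set t : R | 0 < t]
     (fun t : R => complex.Re (fourier phi (t `^ q^-1))) ->
   (forall p lambda : R, 0 < p <= 2 -> 0 < lambda ->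
      schur_concave (@pos_orthant R n.+1) (laplace_moment X q p lambda)) /\
   (forall p : R, 0 < p <= 2 ->
      ('E_P[(fun w => `|X ord0 w| `^ p)%R] < +oo)%E ->
      schur_convex (@pos_orthant R n.+1) (abs_moment X q p))).
Proof.
split=> cpsi.
- have cL p lambda : 0 < p <= 2 -> 0 < lambda ->
      log_convex (@pos_orthant R n.+1) (laplace_moment X q p lambda).
    by move=> p02 l0; apply: (log_convex_laplace hq hindep hlaw hpos p02 l0 cpsi).
  split=> // p p02 Xp; have /andP[p0 _] := p02.
  by apply: (concave_abs_moment hlaw p0 Xp) => lambda; exact: cL.
- have cL p lambda : 0 < p <= 2 -> 0 < lambda ->
      schur_concave (@pos_orthant R n.+1) (laplace_moment X q p lambda).
    by move=> p02 l0; apply: (schur_concave_laplace hq hindep hlaw hpos p02 l0 cpsi).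
  split=> // p p02 Xp; have /andP[p0 _] := p02.
  by apply: (schur_convex_abs_moment hlaw p0 Xp) => lambda; exact: cL.
Qed.
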